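(* Let $\Omega\subset\mathbb{C}^n$ be a smooth, bounded, pseudoconvex domain satisfying Catlin's Property $(P)$. Then the Diederich-Fornaess Index of $\Omega$ is equal to $1$.
   Context: Catlin's Property $(P)$: for every $M>0$ there exists a smooth plurisubharmonic function $\lambda$ on $\overline\Omega$ such that $0\le\lambda\le1$ on $\Omega$ and $i\partial\bar\partial\lambda\ge iM\partial\bar\partial|z|^2$ on $\partial\Omega$. Diederich-Fornaess Index of $\Omega$: the supremum of all exponents $0<\eta<1$ admitting a smooth defining function $\rho_\eta$ for $\Omega$ such that $-(-\rho_\eta)^\eta$ is plurisubharmonic on $\Omega$. *)

(* Defs.v *)
From HB Require Import structures.
From mathcomp Require Import all_boot all_order all_algebra.
From mathcomp Require Import all_classical all_reals all_analysis.
From mathcomp Require Import complex.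

Set Implicit Arguments.
Unset Strict Implicit.
Unset Printing Implicit Defensive.

Import Order.TTheory GRing.Theory Num.Theory.
Import numFieldNormedType.Exports.

Local Open Scope classical_set_scope.
Local Open Scope ring_scope.
Local Open Scope complex_scope.

(* C^n is encoded by real coordinates: z = x + i y is the pair (x, y), so that *)
(* it is a normed module over R and derivatives are real ones.                 *)
Definition Cn (R : realType) (n : nat) : normedModType R :=
  ('rV[R]_n * 'rV[R]_n)%type.

Definition bdry (T : topologicalType) (A : set T) : set T := closure A `\` A^°.

Section Smoothness.
Variables (R : realType) (V : normedModType R).
Implicit Types (f : V -> R) (U A : set V).

Definition iter_derive (vs : seq V) f : V -> R :=
  foldr (fun v g => 'D_v g) f vs.

(* U is meant to be open *)
Definition Ck (k : nat) U f : Prop :=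
  forall (vs : seq V) (z : V), (size vs <= k)%N -> U z ->
    {for z, continuous (iter_derive vs f)} /\
    ((size vs < k)%N -> forall v, derivable (iter_derive vs f) z v).

Definition smooth_on U f : Prop := forall k, Ck k U f.

(* On a set that is not open (such as a closed domain), smoothness means       *)
(* smoothness on some open neighbourhood of that set.                          *)
Definition smooth_near A f : Prop :=
  exists U : set V, [/\ open U, A `<=` U & smooth_on U f].

Definition upper_semicontinuous_on U f : Prop :=
  forall z, U z -> forall a : R, f z < a -> \forall y \near z, U y -> f y < a.

End Smoothness.

Section Complex.
Variables (R : realType) (n : nat).
Implicit Types (z : Cn R n) (w : 'rV[R[i]]_n) (g : Cn R n -> R[i]).

Definition real_derive (v : Cn R n) g : Cn R n -> R[i] :=
  fun z => ('D_v (fun y => complex.Re (g y)) z) +i*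
           ('D_v (fun y => complex.Im (g y)) z).

Definition ddx (j : 'I_n) g := real_derive (delta_mx 0 j, 0) g.
Definition ddy (j : 'I_n) g := real_derive (0, delta_mx 0 j) g.

(* Wirtinger derivatives *)
Definition ddz (j : 'I_n) g : Cn R n -> R[i] :=
  fun z => (ddx j g z - (0 +i* 1) * ddy j g z) / 2%:R.
Definition ddzbar (j : 'I_n) g : Cn R n -> R[i] :=
  fun z => (ddx j g z + (0 +i* 1) * ddy j g z) / 2%:R.

(* The Hermitian form of the real (1,1)-form i d dbar f at z.                  *)
Definition levi_form (f : Cn R n -> R) z w : R[i] :=
  \sum_(j < n) \sum_(k < n)
    ddz j (ddzbar k (fun y => (f y)%:C)) z * w 0 j * conjc (w 0 k).

Definition sqnorm z : R := \sum_(j < n) (z.1 0 j ^+ 2 + z.2 0 j ^+ 2).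

Definition complex_tangent (f : Cn R n -> R) z w : Prop :=
  \sum_(j < n) ddz j (fun y => (f y)%:C) z * w 0 j = 0.

(* The point z + tau v for tau = tau.1 + i tau.2 in the complex plane.         *)
Definition complex_line z (v : Cn R n) (tau : R * R) : Cn R n :=
  (z.1 + (tau.1 *: v.1 - tau.2 *: v.2), z.2 + (tau.2 *: v.1 + tau.1 *: v.2)).

End Complex.

Section Plurisubharmonic.
Variable R : realType.

Definition harmonic_on (U : set (R * R)) (h : R * R -> R) : Prop :=
  Ck 2 U h /\
  forall t, U t -> 'D_(1, 0) ('D_(1, 0) h) t + 'D_(0, 1) ('D_(0, 1) h) t = 0.

(* Hoermander, An Introduction to Complex Analysis in Several Variables,       *)
(* Definitions 1.6.1 and 2.6.1, for functions without the value -oo.           *)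
Definition subharmonic_on (D : set (R * R)) (u : R * R -> R) : Prop :=
  upper_semicontinuous_on D u /\
  forall (K : set (R * R)) (h : R * R -> R),
    compact K -> K `<=` D -> {within K, continuous h} -> harmonic_on K^° h ->
    (forall t, bdry K t -> u t <= h t) -> forall t, K t -> u t <= h t.

Definition psh_on (n : nat) (U : set (Cn R n)) (u : Cn R n -> R) : Prop :=
  upper_semicontinuous_on U u /\
  forall z v : Cn R n,
    subharmonic_on (complex_line z v @^-1` U) (u \o complex_line z v).

End Plurisubharmonic.

Section Domains.
Variables (R : realType) (n : nat).
Implicit Types (Omega : set (Cn R n)) (rho : Cn R n -> R).

Definition domain Omega : Prop :=
  [/\ Omega !=set0, open Omega & connected Omega].

Definition defining_function Omega rho : Prop :=
  exists U : set (Cn R n),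
    [/\ open U, closure Omega `<=` U, smooth_on U rho,
        Omega = U `&` [set z | rho z < 0] &
        forall z, bdry Omega z -> exists v, 'D_v rho z != 0].

Definition smooth_boundary Omega : Prop :=
  exists rho, defining_function Omega rho.

(* Levi pseudoconvexity; the condition does not depend on the choice of the    *)
(* defining function.                                                          *)
Definition pseudoconvex Omega : Prop :=
  exists2 rho, defining_function Omega rho &
    forall z, bdry Omega z -> forall w, complex_tangent rho z w ->
      0 <= levi_form rho z w.

Definition property_P Omega : Prop :=
  forall M : R, 0 < M -> exists lambda : Cn R n -> R,
    [/\ smooth_near (closure Omega) lambda,
        psh_on Omega lambda,
        forall z, Omega z -> 0 <= lambda z <= 1 &
        forall z, bdry Omega z -> forall w,
          M%:C * levi_form (@sqnorm R n) z w <= levi_form lambda z w].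

Definition DF_exponent Omega (eta : R) : Prop :=
  0 < eta < 1 /\
  exists2 rho, defining_function Omega rho &
    psh_on Omega (fun z => - ((- rho z) `^ eta)).

(* sup takes the junk value 0 when there is no such exponent *)
Definition DF_index Omega : R := sup [set eta | DF_exponent Omega eta].

End Domains.

(* Main.v *)
Require Import Defs.
From HB Require Import structures.
From mathcomp Require Import all_boot all_order all_algebra.
From mathcomp Require Import all_classical all_reals all_analysis.
From mathcomp Require Import complex.
From mathcomp Require Import ring lra.

Set Implicit Arguments.
Unset Strict Implicit.
Unset Printing Implicit Defensive.

Import Order.TTheory GRing.Theory Num.Theory.
Import numFieldNormedType.Exports.

Local Open Scope classical_set_scope.
Local Open Scope ring_scope.

(** Exponents are less than 1 by definition, so the point is that every eta in ]0, 1[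
    is a Diederich-Fornaess exponent.  Write L_f for the Levi form of f and |df| for
    the modulus of its complex derivative, both along a fixed vector v.

    Let r be a defining function, s = - r, and rho = r exp(-psi).  On Omega the function
    -(-rho)^(1 - theta) is plurisubharmonic where
      L_rho + theta |d rho|^2 / |rho| >= 0.
    Up to the factor exp(-psi) and after absorbing cross terms, this follows from
      L_r + (theta / 2) |dr|^2 / s + s (L_psi - (2 / theta) |d psi|^2) >= 0.
    Pseudoconvexity gives L_r >= - C s |v|^2 - C |dr| |v| near the boundary, with C
    depending on r only ([pseudoconvex_local], made uniform by [collar_uniform]).
    The second error is absorbed by |dr|^2 / s, at the price of another multiple of
    s |v|^2.  What remains has to be compensated by psi.  For lambda given by property
    (P) and psi = kappa (1 + lambda)^2 with kappa = theta / 16, one has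
    L_psi - (2 / theta) |d psi|^2 >= 2 kappa L_lambda because lambda takes its values in
    [0, 1], and L_lambda is as large as desired near the boundary.  Hence the
    inequality on a collar -b < rho < 0 ([collar_inequality]).

    At greater depth no such inequality is available, and rho is replaced by
    h(rho), where h(t) = E(t + b) - E(b) with E(x) = exp(-1/x) for x > 0 and
    E(x) = 0 otherwise.  This is smooth, still defines Omega, and is constant where
    rho <= -b.  In the collar, composing with h costs a fixed factor in theta:
    -(-h(rho))^eta is plurisubharmonic for eta = 1 - 5 theta ([cutoff]).

    Derivatives are taken along real directions.  With J the multiplication by i,
    4 L_f = D_v D_v f + D_Jv D_Jv f ([Re_levi_form]), so that the estimates concern real
    quadratic forms on a normed space with finitely many coordinates.
    Plurisubharmonicity in the sense of harmonic majorants is recovered from the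
    sign of the Levi form by a maximum principle ([psh_levi2]). *)

(** * Derivatives along lines *)

Section DirectionalCalculus.
Variables (R : realType) (V : normedModType R).
Implicit Types (f g : V -> R) (z v w : V).

Lemma is_derive_line (W : normedModType R) (f : V -> W) z v (t : R) df :
  is_derive (z + t *: v) v f df ->
  is_derive t 1 (fun s : R => f (z + s *: v)) df.
Proof.
move=> fd.
have E : (fun h : R => h^-1 *: (((fun s : R => f (z + s *: v)) \o shift t) (h *: 1) -
    f (z + t *: v))) =
    (fun h : R => h^-1 *: ((f \o shift (z + t *: v)) (h *: v) - f (z + t *: v))).
  apply/funext => h /=; congr (_ *: (f _ - _)).
  by rewrite [h *: 1]mulr1 scalerDl addrCA.
have [d1 d2] := fd.
by split; rewrite /derivable /derive E.
Qed.

Lemma is_derive_comp1 f (h : R -> R) z v dh df :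
  is_derive z v f df -> is_derive (f z) 1 h dh ->
  is_derive z v (h \o f) (dh * df).
Proof.
move=> [fd fE] hd.
have fl : is_derive (0 : R) 1 (fun s : R => f (z + s *: v)) df.
  by apply: is_derive_line; rewrite scale0r addr0; split.
have hd' : is_derive (f (z + 0 *: v)) 1 h dh by rewrite scale0r addr0.
have [c1 c2] := @is_derive1_comp _ h (fun s => f (z + s *: v)) 0 dh df hd' fl.
have E : (fun k : R => k^-1 *: (((h \o (fun s : R => f (z + s *: v))) \o shift 0)
    (k *: 1) - (h \o (fun s : R => f (z + s *: v))) 0)) =
    (fun k : R => k^-1 *: (((h \o f) \o shift z) (k *: v) - (h \o f) z)).
  apply/funext => k /=; rewrite scale0r !addr0 [k *: 1]mulr1.
  by rewrite [z + _]addrC.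
by split; move: c1 c2; rewrite /derivable /derive E.
Qed.

(** The mean value theorem needs only the derivative along the segment itself,
    which is what the directional notion of smoothness offers. *)
Lemma MVT_line f z v :
  (forall t : R, 0 <= t <= 1 -> derivable f (z + t *: v) v) ->
  exists2 c : R, 0 <= c <= 1 & f (z + v) - f z = 'D_v f (z + c *: v).
Proof.
move=> fd.
have fd' (t : R) : 0 <= t <= 1 ->
    is_derive t 1 (fun s : R => f (z + s *: v)) ('D_v f (z + t *: v)).
  by move=> t01; apply: is_derive_line; split => //; exact: fd.
have [||c c01] := @MVT_segment R (fun s => f (z + s *: v))
    (fun t => 'D_v f (z + t *: v)) 0 1 ler01.
- by move=> t; rewrite in_itv /= => /andP[t0 t1]; apply: fd'; rewrite !ltW.
- apply: derivable_within_continuous => t; rewrite in_itv /= => t01.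
  by have [] := fd' t t01.
rewrite scale1r scale0r addr0 subr0 mulr1 => E.
by exists c => //; move: c01; rewrite in_itv.
Qed.

Lemma is_derive_scaledir f z v (k : R) df :
  is_derive z v f df -> is_derive z (k *: v) f (k * df).
Proof.
move=> fd.
have fl : is_derive (0 : R) 1 (fun s : R => f (z + s *: v)) df.
  by apply: is_derive_line; rewrite scale0r addr0.
have hd : is_derive (0 : R) 1 (fun s : R => s * k) k.
  by apply: is_derive_eq; rewrite /GRing.scale /=; ring.
have fl' : is_derive ((fun s : R => s * k) 0) 1 (fun s : R => f (z + s *: v)) df.
  by rewrite mul0r.
have [c1 c2] := @is_derive1_comp _ (fun s => f (z + s *: v)) (fun s => s * k) 0 df k fl' hd.
have E : (fun h : R => h^-1 *: ((((fun s : R => f (z + s *: v)) \o (fun s : R => s * k))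
     \o shift 0) (h *: 1) - ((fun s : R => f (z + s *: v)) \o (fun s : R => s * k)) 0)) =
    (fun h : R => h^-1 *: ((f \o shift z) (h *: (k *: v)) - f z)).
  apply/funext => h /=; rewrite mul0r scale0r !addr0 [h *: 1]mulr1 scalerA.
  by rewrite [z + _]addrC.
by rewrite mulrC; split; move: c1 c2; rewrite /derivable /derive E.
Qed.

Lemma derive_scaledir f z v (k : R) : derivable f z v ->
  'D_(k *: v) f z = k * 'D_v f z.
Proof. by move=> fd; have [_ ->] := is_derive_scaledir k (derivableP fd). Qed.

End DirectionalCalculus.

(** * Calculus of smooth functions *)

Section SmoothCalculus.
Variables (R : realType) (V : normedModType R).
Implicit Types (f g : V -> R) (U A : set V) (z v w : V).

Lemma smooth_onP U f : smooth_on U f <->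
  forall (vs : seq V) z, U z -> {for z, continuous (iter_derive vs f)} /\
    forall v, derivable (iter_derive vs f) z v.
Proof.
split=> [fs vs z Uz|fs k vs z _ Uz]; last by have [c d] := fs vs z Uz; split.
have [c d] := fs (size vs).+1 vs z (leqnSn _) Uz.
by split => //; exact: d.
Qed.

Lemma smooth_continuous U f z : smooth_on U f -> U z -> {for z, continuous f}.
Proof. by move=> /smooth_onP /(_ [::] z) + Uz => /(_ Uz) []. Qed.

Lemma smooth_derivable U f z v : smooth_on U f -> U z -> derivable f z v.
Proof. by move=> /smooth_onP /(_ [::] z) + Uz => /(_ Uz) [] _; exact. Qed.

Arguments smooth_derivable {U f z} v _ _.

Lemma smooth_is_derive U f z v : smooth_on U f -> U z ->
  is_derive z v f ('D_v f z).
Proof. by move=> fs Uz; apply: derivableP; exact: smooth_derivable fs Uz. Qed.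

Lemma iter_derive_rcons (vs : seq V) v f :
  iter_derive (rcons vs v) f = iter_derive vs ('D_v f).
Proof. by rewrite /iter_derive foldr_rcons. Qed.

Lemma smooth_derive U f v : smooth_on U f -> smooth_on U ('D_v f).
Proof.
move=> /smooth_onP fs; apply/smooth_onP => vs z Uz.
by rewrite -iter_derive_rcons; exact: fs.
Qed.

Lemma smooth_iter_derive U f (vs : seq V) :
  smooth_on U f -> smooth_on U (iter_derive vs f).
Proof. by move=> fs; elim: vs => [|v vs IH]; [exact: fs|exact: smooth_derive IH]. Qed.

Lemma smooth_onS U A f : A `<=` U -> smooth_on U f -> smooth_on A f.
Proof.
move=> AU /smooth_onP fs; apply/smooth_onP => vs z Az; exact: fs (AU _ Az).
Qed.

Lemma open_near_eq U f g z : open U -> U z -> (forall y, U y -> f y = g y) ->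
  {near z, f =1 g}.
Proof. by move=> oU Uz fg; exact: filterS fg (open_nbhs_nbhs (conj oU Uz)). Qed.

Lemma near_derivable f g z v : {near z, f =1 g} -> derivable f z v ->
  derivable g z v.
Proof. by move=> fg fd; have [] := near_eq_is_derive fg (derivableP fd). Qed.

Arguments near_derivable {f g z v} _ _.

(** Smoothness is coinductive: a family of functions whose first derivatives
    again lie in the family (up to equality on [U]) consists of smooth
    functions.  Higher derivatives of
    products and compositions then never have to be written out. *)
Lemma smooth_coind U (S : (V -> R) -> Prop) : open U ->
  (forall f z, S f -> U z -> {for z, continuous f} /\ forall v, derivable f z v) ->
  (forall f v, S f -> exists2 g, S g & forall z, U z -> 'D_v f z = g z) ->
  forall f, S f -> smooth_on U f.
Proof.
move=> oU S0 SD f Sf; apply/smooth_onP => vs.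
have [g Sg fg] : exists2 g, S g & forall z, U z -> iter_derive vs f z = g z.
  elim: vs => [|v vs [g Sg fg]] /=; first by exists f.
  have [g' Sg' gg'] := SD g v Sg; exists g' => // z Uz.
  by rewrite -gg'//; apply: near_eq_derive; exact: open_near_eq oU Uz fg.
move=> z Uz; have [gc gd] := S0 g z Sg Uz.
have gf : {near z, g =1 iter_derive vs f}.
  by apply: open_near_eq oU Uz _ => y Uy; rewrite fg.
split=> [|v]; last exact: near_derivable gf (gd v).
rewrite /prop_for /continuous_at fg//.
exact: cvg_trans (near_eq_cvg gf) gc.
Qed.

Definition smooth1 (h : R -> R) := forall k (x : R), derivable (derive1n k h) x 1.

Lemma smooth1_derive1 h : smooth1 h -> smooth1 (derive1 h).
Proof. by move=> hs k x; rewrite -derive1Sn. Qed.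

Lemma smooth1_is_derive h (x : R) : smooth1 h -> is_derive x 1 h ((derive1 h) x).
Proof. by move=> hs; rewrite derive1E; apply: derivableP; exact: (hs 0%N x). Qed.

Lemma smooth1_continuous h : smooth1 h -> continuous h.
Proof.
move=> hs x; apply/differentiable_continuous/derivable1_diffP.
exact: (hs 0%N x).
Qed.

(** The closure of the smooth functions under the operations below is stable under
    differentiation by the Leibniz and chain rules; [smooth_coind] then applies to
    it, and closure under each operation follows at once. *)
Inductive smooth_alg U : (V -> R) -> Prop :=
| smooth_alg_base f : smooth_on U f -> smooth_alg U f
| smooth_alg_add f g : smooth_alg U f -> smooth_alg U g -> smooth_alg U (f + g)
| smooth_alg_mul f g : smooth_alg U f -> smooth_alg U g -> smooth_alg U (f * g)
| smooth_alg_comp h f : smooth1 h -> smooth_alg U f -> smooth_alg U (h \o f).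

Lemma smooth_alg_smooth U f : open U -> smooth_alg U f -> smooth_on U f.
Proof.
move=> oU.
have S0 k z : smooth_alg U k -> U z ->
    {for z, continuous k} /\ forall v, derivable k z v.
  move=> + Uz; elim=> {f k} [f fs|f g _ [fc fd] _ [gc gd]|f g _ [fc fd] _ [gc gd]|h f hs _ [fc fd]].
  - by split=> [|v]; [exact: smooth_continuous fs Uz|exact: smooth_derivable fs Uz].
  - by split=> [|v]; [exact: cvgD|exact: derivableD].
  - by split=> [|v]; [exact: cvgM|exact: derivableM].
  - split=> [|v]; first by apply: continuous_comp; [exact: fc|exact: smooth1_continuous].
    by have [] := is_derive_comp1 (derivableP (fd v)) (smooth1_is_derive (f z) hs).
apply: (smooth_coind oU S0) => {}f v.
elim=> {f} [f fs|f g fa [f' f'a fE] ga [g' g'a gE]|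
    f g fa [f' f'a fE] ga [g' g'a gE]|h f hs fa [f' f'a fE]].
- by exists ('D_v f) => //; apply: smooth_alg_base; exact: smooth_derive.
- exists (f' + g'); first exact: smooth_alg_add.
  by move=> z Uz; rewrite deriveD ?fE ?gE//; [apply: (S0 f z _ _).2|apply: (S0 g z _ _).2].
- exists (f * g' + g * f'); first by apply: smooth_alg_add; exact: smooth_alg_mul.
  move=> z Uz; rewrite deriveM ?fE ?gE//; [by apply: (S0 f z _ _).2|by apply: (S0 g z _ _).2].
- exists (((derive1 h) \o f) * f').
    apply: smooth_alg_mul; last exact: f'a.
    by apply: smooth_alg_comp; [exact: smooth1_derive1|exact: fa].
  move=> z Uz; have [_ fd] := S0 f z fa Uz.
  have [_ ->] := is_derive_comp1 (derivableP (fd v)) (smooth1_is_derive (f z) hs).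
  by rewrite fE.
Qed.

Lemma smooth_add U f g : open U -> smooth_on U f -> smooth_on U g ->
  smooth_on U (f + g).
Proof.
by move=> oU fs gs; apply: smooth_alg_smooth => //; apply: smooth_alg_add; exact: smooth_alg_base.
Qed.

Lemma smooth_mul U f g : open U -> smooth_on U f -> smooth_on U g ->
  smooth_on U (f * g).
Proof.
by move=> oU fs gs; apply: smooth_alg_smooth => //; apply: smooth_alg_mul; exact: smooth_alg_base.
Qed.

Lemma smooth_comp U h f : open U -> smooth1 h -> smooth_on U f ->
  smooth_on U (h \o f).
Proof.
by move=> oU hs fs; apply: smooth_alg_smooth => //; apply: smooth_alg_comp => //; exact: smooth_alg_base.
Qed.

Lemma smooth_cst U (c : R) : open U -> smooth_on U (cst c).
Proof.
move=> oU; apply: (@smooth_coind U (fun f => exists c, f = cst c)) => //.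
- move=> _ z [{}c ->] _; split=> [|v]; [exact: cst_continuous|exact: derivable_cst].
- by move=> _ v [{}c ->]; exists (cst 0); [exists 0|move=> z _; rewrite derive_cst].
- by exists c.
Qed.

Lemma is_derive_linear (l : V -> R) z v :
  (forall a u w, l (a *: u + w) = a * l u + l w) -> is_derive z v l (l v).
Proof.
move=> lin.
have E : (fun h : R => h^-1 *: ((l \o shift z) (h *: v) - l z)) @ 0^' --> l v.
  apply: cvg_near_cst; near=> h => /=.
  have h0 : h != 0 by near: h; exact: nbhs_dnbhs_neq.
  by rewrite lin addrK -[LHS]/(h^-1 * (h * l v)) mulKf.
by split; [apply/cvg_ex; exists (l v)|exact: cvg_lim].
Unshelve. all: by end_near. Qed.

Lemma smooth_linear U (l : V -> R) : open U ->
  (forall a u w, l (a *: u + w) = a * l u + l w) ->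
  (forall v, `|l v| <= `|v|) -> smooth_on U l.
Proof.
move=> oU lin lb.
have lc : continuous l.
  move=> z; apply/cvgrPdist_lt => e e0.
  have H : \forall y \near z, `|z - y| < e.
    by move/cvgrPdist_lt : (@cvg_id _ (nbhs z)); exact.
  near=> y.
  have -> : l z - l y = l (z - y).
    by have := lin (-1) y z; rewrite scaleN1r mulN1r [- y + z]addrC => ->; rewrite addrC.
  by rewrite (le_lt_trans (lb _))//; near: y.
apply: (@smooth_coind U (fun f => (exists c, f = cst c) \/ f = l)) => //; last by right.
- move=> _ z [[c ->]|->] _.
    by split=> [|v]; [exact: cst_continuous|exact: derivable_cst].
  by split=> [|v]; [exact: lc|have [] := is_derive_linear z v lin].
- move=> _ v [[c ->]|->].
    by exists (cst 0); [left; exists 0|move=> z _; rewrite derive_cst].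
  exists (cst (l v)); first by left; exists (l v).
  by move=> z _; have [_ ->] := is_derive_linear z v lin.
Unshelve. all: by end_near. Qed.

End SmoothCalculus.

Arguments smooth_derivable {R V U f z} v _ _.
Arguments near_derivable {R V f g z v} _ _.

(** * Linearity of the derivative in the direction *)

Section LinearityInDirection.
Variables (R : realType) (V : normedModType R).
Implicit Types (f g : V -> R) (U A : set V) (z v w : V).

Lemma nbhs_normP z (P : set V) : (\forall y \near z, P y) <->
  exists2 e : R, 0 < e & forall y, `|y - z| < e -> P y.
Proof.
split=> [/nbhs_ballP[e /= e0 eP]|[e e0 eP]].
  by exists e => // y yz; apply: eP; rewrite -ball_normE /ball_ /= distrC.
apply/nbhs_ballP; exists e => //= y; rewrite -ball_normE /ball_ /= distrC.
exact: eP.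
Qed.

(** Continuity of the directional derivatives (rather than differentiability)
    is all that a smooth function provides, so additivity in the direction comes
    from moving first along [v], then along [w], with the mean value theorem on
    the second leg. *)
Lemma derive_dirD U f z v w : open U -> smooth_on U f -> U z ->
  'D_(v + w) f z = 'D_v f z + 'D_w f z.
Proof.
move=> oU fs Uz; apply/esym.
suff H : (fun h : R => h^-1 *: ((f \o shift z) (h *: (v + w)) - f z)) @ 0^' -->
    'D_v f z + 'D_w f z by rewrite -(cvg_lim _ H).
have E : (fun h : R => h^-1 *: ((f \o shift z) (h *: (v + w)) - f z)) =
    (fun h : R => h^-1 *: ((f \o shift z) (h *: v) - f z)) +
    (fun h : R => h^-1 *: (f (h *: v + z + h *: w) - f (h *: v + z))).
  apply/funext => h; rewrite /= fctE -scalerDr; congr (_ *: _).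
  by rewrite scalerDr -addrA [h *: w + z]addrC addrA [RHS]addrC addrA subrK.
rewrite E; apply: cvgD; first by have := smooth_derivable v fs Uz; exact.
apply/cvgrPdist_lt => e e0.
have /nbhs_normP[d d0 dP] : \forall y \near z, U y /\ `|'D_w f z - 'D_w f y| < e.
  near=> y; split; first by near: y; exact: open_nbhs_nbhs.
  near: y; move/cvgrPdist_lt : (smooth_continuous (smooth_derive w fs) Uz); exact.
pose k := `|v| + `|w| + 1.
have k0 : 0 < k by rewrite /k; have := normr_ge0 v; have := normr_ge0 w; lra.
have hk : \forall h \near (0 : R)^', h != 0 /\ `|h| < d / k.
  near=> h; split; first by near: h; exact: nbhs_dnbhs_neq.
  near: h; apply: (@dnbhs0_lt _ R^o); exact: divr_gt0.
near=> h.
have [h0 hd] : h != 0 /\ `|h| < d / k by near: h.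
have hz (t : R) : 0 <= t <= 1 -> `|h *: v + z + t *: (h *: w) - z| < d.
  move=> /andP[t0 t1]; rewrite addrAC addrK.
  rewrite (le_lt_trans (ler_normD _ _))// !normrZ (ger0_norm t0).
  have : `|h| * k < d by rewrite -ltr_pdivlMr.
  have hn := normr_ge0 h; have wn := mulr_ge0 hn (normr_ge0 w).
  have -> : `|h| * k = `|h| * `|v| + `|h| * `|w| + `|h| by rewrite /k; ring.
  have : t * (`|h| * `|w|) <= `|h| * `|w| by rewrite ler_piMl.
  lra.
have [|c c01 cE] := @MVT_line _ _ f (h *: v + z) (h *: w).
  move=> t t01; apply: (smooth_derivable _ fs).
  by have [] := dP _ (hz t t01).
rewrite cE derive_scaledir; last first.
  by apply: (smooth_derivable _ fs); have [] := dP _ (hz c c01).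
rewrite -[X in _ - X]/(h^-1 * (h * _)) mulKf//.
by have [] := dP _ (hz c c01).
Unshelve. all: by end_near. Qed.

Lemma derive_dirZ U f z v (k : R) : smooth_on U f -> U z ->
  'D_(k *: v) f z = k * 'D_v f z.
Proof. by move=> fs Uz; apply: derive_scaledir; exact: smooth_derivable fs Uz. Qed.

Lemma derive_dir_sum U f z (I : finType) (c : I -> V) : open U ->
  smooth_on U f -> U z ->
  'D_(\sum_i c i) f z = \sum_i 'D_(c i) f z.
Proof.
move=> oU fs Uz.
apply: (big_ind2 (fun x y => 'D_x f z = y)) => //.
- exact: derive0.
- by move=> x1 x2 y1 y2 <- <-; exact: derive_dirD oU fs Uz.
Qed.

End LinearityInDirection.

(** * Bounds that are uniform in the direction *)

Section FiniteDimension.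
Variables (R : realType) (V : normedModType R) (I : finType).
Variables (e : I -> V) (c : V -> I -> R).
Hypothesis coordE : forall v, v = \sum_i c v i *: e i.
Hypothesis coord_le : forall v i, `|c v i| <= `|v|.
Implicit Types (f g : V -> R) (U A : set V) (z v w : V).

Lemma derive_coord U f z v : open U -> smooth_on U f -> U z ->
  'D_v f z = \sum_i c v i * 'D_(e i) f z.
Proof.
move=> oU fs Uz; rewrite {1}(coordE v) (derive_dir_sum _ oU fs Uz).
by apply: eq_bigr => j _; rewrite (derive_dirZ _ _ fs Uz).
Qed.

Lemma derive_smooth_sum U f v z (a : I -> R) (g : I -> V -> R) :
  open U -> U z -> (forall i, smooth_on U (g i)) ->
  (forall y, U y -> f y = \sum_i a i * g i y) ->
  'D_v f z = \sum_i a i * 'D_v (g i) z.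
Proof.
move=> oU Uz gs fE.
have -> : 'D_v f z = 'D_v (fun y => \sum_i a i * g i y) z.
  by apply: near_eq_derive; exact: open_near_eq oU Uz fE.
have D i : is_derive z v (a i *: g i) (a i * 'D_v (g i) z).
  by apply: is_deriveZ; exact: smooth_is_derive (gs i) Uz.
have -> : (fun y => \sum_i a i * g i y) = \sum_i (a i *: g i).
  by apply/funext => y; rewrite fct_sumE.
have : is_derive z v (\sum_i (a i *: g i)) (\sum_i a i * 'D_v (g i) z).
  elim/big_ind2 : _ => [|x1 x2 y1 y2 h1 h2|i _]; first exact: is_derive_cst.
    exact: is_deriveD.
  exact: D.
by move=> [_ ->].
Qed.

Lemma derive2_coord U f z v w : open U -> smooth_on U f -> U z ->
  'D_v ('D_w f) z = \sum_i \sum_j c v i * (c w j * 'D_(e i) ('D_(e j) f) z).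
Proof.
move=> oU fs Uz; rewrite (derive_coord _ oU (smooth_derive w fs) Uz).
apply: eq_bigr => i _; rewrite -mulr_sumr; congr (_ * _).
apply: (derive_smooth_sum _ oU Uz) => [j|y Uy]; first exact: smooth_derive.
exact: derive_coord oU fs Uy.
Qed.

Lemma iter_derive_sum U f z (vs : seq V) (a : I -> R) (g : I -> V -> R) :
  open U -> U z -> (forall i, smooth_on U (g i)) ->
  (forall y, U y -> f y = \sum_i a i * g i y) ->
  iter_derive vs f z = \sum_i a i * iter_derive vs (g i) z.
Proof.
move=> oU + gs fE; elim: vs z => [|v vs IH] z Uz /=; first exact: fE.
apply: (@derive_smooth_sum U _ v z a (fun i => iter_derive vs (g i)) oU Uz).
  by move=> i; exact: smooth_iter_derive.
exact: IH.
Qed.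

(** Continuity alone bounds each derivative near a point; linearity in the
    directions then makes the bound uniform over all directions, since the
    coordinate directions are finitely many. *)
Lemma iter_derive_bound k f U z0 : open U -> smooth_on U f -> U z0 ->
  exists2 C : R, 0 <= C & \forall z \near z0, forall vs : seq V, size vs = k ->
    `|iter_derive vs f z| <= C * \prod_(v <- vs) `|v|.
Proof.
move=> oU; elim: k f => [|k IH] f fs Uz0.
  exists (`|f z0| + 1); first by rewrite addr_ge0.
  have H : \forall z \near z0, `|f z0 - f z| < 1.
    by move/cvgrPdist_lt : (smooth_continuous fs Uz0); apply.
  near=> z => vs /size0nil ->; rewrite big_nil mulr1 /=.
  have : `|f z0 - f z| < 1 by near: z.
  rewrite distrC => H1; rewrite -(subrK (f z0) (f z)) (le_trans (ler_normD _ _))//.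
  by rewrite addrC lerD2l ltW.
have /fin_all_exists2[C C0 CP] i := IH ('D_(e i) f) (smooth_derive (e i) fs) Uz0.
exists (\sum_i C i); first exact: sumr_ge0.
have CP' : \forall z \near z0, forall i, forall vs : seq V, size vs = k ->
    `|iter_derive vs ('D_(e i) f) z| <= C i * \prod_(v <- vs) `|v|.
  exact: filter_forall.
near=> z => vs; case/lastP: vs => // vs v; rewrite size_rcons => -[vsk].
have Uz : U z by near: z; exact: open_nbhs_nbhs.
have Cz : forall i, forall vs : seq V, size vs = k ->
    `|iter_derive vs ('D_(e i) f) z| <= C i * \prod_(v <- vs) `|v| by near: z.
rewrite iter_derive_rcons (@iter_derive_sum U _ z vs (c v) (fun i => 'D_(e i) f) oU Uz); last 2 first.
- by move=> i; exact: smooth_derive.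
- by move=> y Uy; exact: (derive_coord _ oU fs Uy).
rewrite (le_trans (ler_norm_sum _ _ _))// mulr_suml; apply: ler_sum => i _.
rewrite normrM -cats1 big_cat big_seq1 /= mulrA mulrC ler_pM//.
exact: Cz.
Unshelve. all: by end_near. Qed.

Lemma segment_ball z0 y y' (d t : R) : `|y - z0| < d -> `|y' - z0| < d ->
  0 <= t <= 1 -> `|y + t *: (y' - y) - z0| < d.
Proof.
move=> yd y'd /andP[t0 t1].
have -> : y + t *: (y' - y) - z0 = (1 - t) *: (y - z0) + t *: (y' - z0).
  have -> : y' - y = (y' - z0) - (y - z0) by rewrite opprB addrA subrK.
  rewrite [LHS]addrAC; move: (y - z0) (y' - z0) => a b.
  by rewrite scalerBr scalerBl scale1r -addrA [- _ + _]addrC.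
rewrite (le_lt_trans (ler_normD _ _))// !normrZ !ger0_norm ?subr_ge0//.
have [->|t0'] := eqVneq t 0; first by rewrite mul0r subr0 mul1r addr0.
have tp : 0 < t by rewrite lt0r t0'.
have : (1 - t) * `|y - z0| <= (1 - t) * d by rewrite ler_wpM2l ?subr_ge0// ltW.
have : t * `|y' - z0| < t * d by rewrite ltr_pM2l.
lra.
Qed.

Lemma lipschitz_ball g z0 (d K : R) :
  (forall y, `|y - z0| < d -> forall v, derivable g y v /\ `|'D_v g y| <= K * `|v|) ->
  forall y y', `|y - z0| < d -> `|y' - z0| < d -> `|g y' - g y| <= K * `|y' - y|.
Proof.
move=> gK y y' yd y'd.
have [|t t01 E] := @MVT_line _ _ g y (y' - y).
  by move=> t t01; apply: (gK _ _ _).1; exact: segment_ball.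
move: E; rewrite [y + (_ - _)]addrC subrK => ->.
by apply: (gK _ _ _).2; exact: segment_ball.
Qed.

(** Uniform control of a smooth function on a small ball, with one constant for
    all directions: the Lipschitz bounds come from the mean value theorem and
    bounds on one more derivative. *)
Lemma local_bounds f U z0 : open U -> smooth_on U f -> U z0 ->
  exists d C : R, [/\ 0 < d, 0 < C & forall y, `|y - z0| < d ->
    [/\ U y, forall v, `|'D_v f y| <= C * `|v|,
      forall v w, `|'D_v ('D_w f) y| <= C * (`|v| * `|w|) &
      forall y', `|y' - z0| < d ->
       (forall v, `|'D_v f y' - 'D_v f y| <= C * `|v| * `|y' - y|) /\
       (forall v w, `|'D_v ('D_w f) y' - 'D_v ('D_w f) y| <=
         C * (`|v| * `|w|) * `|y' - y|)]].
Proof.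
move=> oU fs Uz0.
have [C1 C10 H1] := iter_derive_bound 1 oU fs Uz0.
have [C2 C20 H2] := iter_derive_bound 2 oU fs Uz0.
have [C3 C30 H3] := iter_derive_bound 3 oU fs Uz0.
pose C := C1 + C2 + C3 + 1.
have : \forall z \near z0, [/\ U z, forall v, `|'D_v f z| <= C * `|v|,
    forall v w, `|'D_v ('D_w f) z| <= C * (`|v| * `|w|) &
    forall v w x, `|'D_x ('D_v ('D_w f)) z| <= C * (`|v| * `|w|) * `|x|].
  near=> z; split.
  - by near: z; exact: open_nbhs_nbhs.
  - move=> v; have : `|'D_v f z| <= C1 * \prod_(u <- [:: v]) `|u|.
      by apply: (near H1 z _ [:: v]).
    rewrite big_seq1 => /le_trans; apply; rewrite ler_wpM2r// /C; lra.
  - move=> v w; have : `|'D_v ('D_w f) z| <= C2 * \prod_(u <- [:: v; w]) `|u|.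
      by apply: (near H2 z _ [:: v; w]).
    rewrite !big_cons big_nil mulr1 => /le_trans; apply.
    by rewrite ler_wpM2r ?mulr_ge0// /C; lra.
  - move=> v w x.
    have : `|'D_x ('D_v ('D_w f)) z| <= C3 * \prod_(u <- [:: x; v; w]) `|u|.
      by apply: (near H3 z _ [:: x; v; w]).
    rewrite !big_cons big_nil mulr1 => /le_trans; apply.
    rewrite -mulrA [_ * `|x|]mulrC.
    by rewrite ler_wpM2r ?mulr_ge0// /C; lra.
move=> /nbhs_normP[d d0 dP]; exists d, C; split => //.
  by rewrite /C; lra.
move=> y yd; have [Uy h1 h2 h3] := dP y yd; split => // y' y'd.
split=> [v|v w].
  have K x : `|x - z0| < d -> forall u, derivable ('D_v f) x u /\
      `|'D_u ('D_v f) x| <= C * `|v| * `|u|.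
    move=> xd u; have [Ux _ h2' _] := dP x xd; split.
      exact: smooth_derivable (smooth_derive v fs) Ux.
    by rewrite -mulrA [`|v| * _]mulrC; exact: h2'.
  exact: (lipschitz_ball K yd y'd).
have K x : `|x - z0| < d -> forall u, derivable ('D_v ('D_w f)) x u /\
    `|'D_u ('D_v ('D_w f)) x| <= C * (`|v| * `|w|) * `|u|.
  move=> xd u; have [Ux _ _ h3'] := dP x xd; split; last exact: h3'.
  exact: smooth_derivable (smooth_derive v (smooth_derive w fs)) Ux.
exact: (lipschitz_ball K yd y'd).
Unshelve. all: by end_near. Qed.

End FiniteDimension.

(** * The distance to the boundary *)

Section BoundaryProjection.
Variables (R : realType) (V : normedModType R).
Implicit Types (U Omega : set V) (r : V -> R) (z v p : V).

Lemma bdry_of_open Omega p : open Omega -> closure Omega p -> ~ Omega p ->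
  bdry Omega p.
Proof. by move=> oO cp np; split => //; rewrite /interior => /nbhs_singleton. Qed.

Lemma bdry_not_in Omega p : open Omega -> bdry Omega p -> ~ Omega p.
Proof. by move=> oO [_ pi] Op; apply: pi; exact: open_nbhs_nbhs. Qed.

(** Moving from [z] along a direction transverse to the boundary, the defining
    function grows at a definite rate, hence the boundary is met after a distance
    comparable to its depth at [z]. *)
Lemma bdry_projection U Omega r p0 : open U -> smooth_on U r -> U p0 ->
  Omega = U `&` [set z | r z < 0] -> r p0 = 0 -> (exists v, 'D_v r p0 != 0) ->
  exists2 K : R, 0 < K & forall d : R, 0 < d -> \forall z \near p0, Omega z ->
    exists p, [/\ bdry Omega p, `|p - p0| < d & `|p - z| <= K * - r z].
Proof.
move=> oU rs Up0 OE rp0 [v0 v0N].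
have [v vP] : exists v, 0 < 'D_v r p0.
  have [|v0lt|/eqP] := ltgtP ('D_v0 r p0) 0; last by rewrite (negPf v0N).
    exists ((-1) *: v0); rewrite (derive_dirZ _ _ rs Up0); lra.
  by exists v0.
have [k k0 kD] : exists2 k, 0 < k & k < 'D_v r p0.
  by exists ('D_v r p0 / 2); lra.
have oO : open Omega.
  rewrite OE openE => y [Uy ry].
  apply: filterI; first exact: open_nbhs_nbhs.
  exact: (cvgr_lt (r y) (smooth_continuous rs Uy)).
have [d0 d00 dP] : exists2 e : R, 0 < e &
    forall y, `|y - p0| < e -> U y /\ k < 'D_v r y.
  apply/nbhs_normP; near=> y; split; first by near: y; exact: open_nbhs_nbhs.
  by near: y; exact: (cvgr_gt _ (smooth_continuous (smooth_derive v rs) Up0)).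
(* The added 1 only keeps the constant positive. *)
pose N := `|v| + 1.
have N0 : 0 < N by rewrite /N; have := normr_ge0 v; lra.
exists (N / k); first exact: divr_gt0.
move=> d' d'0; pose d := Num.min d' d0.
have dgt0 : 0 < d by rewrite lt_min d'0.
have rsmall : \forall z \near p0, - r z < d / 2 * (k / N).
  have E : \forall z \near p0, - (d / 2 * (k / N)) < r z.
    apply: (cvgr_gt _ (smooth_continuous rs Up0)).
    by rewrite rp0 oppr_lt0 mulr_gt0 ?divr_gt0.
  by apply: filterS E => z; lra.
have zsmall : \forall z \near p0, `|z - p0| < d / 2.
  by apply/nbhs_normP; exists (d / 2) => //; rewrite divr_gt0.
near=> z => Oz; have [Uz rz] : U z /\ r z < 0 by rewrite -/(_ z) OE in Oz.
have zd : `|z - p0| < d / 2 by near: z.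
have sd : - r z < d / 2 * (k / N) by near: z.
pose T := - r z / k.
have T0 : 0 < T by rewrite divr_gt0// oppr_gt0.
have TN : T * N < d / 2.
  have -> : T * N = - r z / (k / N). by rewrite /T mulrAC invf_div mulrA.
  by rewrite ltr_pdivrMr ?divr_gt0.
have inball t : 0 <= t <= T -> `|z + t *: v - p0| < d.
  move=> /andP[t0 tT]; rewrite addrAC (le_lt_trans (ler_normD _ _))// normrZ ger0_norm//.
  have : t * `|v| <= T * N by rewrite ler_pM// /N; lra.
  lra.
have inball0 t : 0 <= t <= T -> `|z + t *: v - p0| < d0.
  by move=> /inball /lt_le_trans; apply; rewrite /d ge_min lexx orbT.
(* Along the segment the function grows at rate at least [k]. *)
have growth t t' : 0 <= t -> t <= t' -> t' <= T ->
    k * (t' - t) <= r (z + t' *: v) - r (z + t *: v).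
  move=> t0 tt' t'T.
  have lin (a : R) : z + t *: v + a *: ((t' - t) *: v) = z + (t + a * (t' - t)) *: v.
    by rewrite scalerA -addrA -scalerDl.
  have seg (a : R) : 0 <= a <= 1 -> 0 <= t + a * (t' - t) <= T.
    by move=> /andP[a0 a1]; apply/andP; split; nra.
  have [a a01|a a01] := @MVT_line _ _ r (z + t *: v) ((t' - t) *: v).
    rewrite lin; apply: (smooth_derivable _ rs).
    by have [] := dP _ (inball0 _ (seg a a01)).
  have -> : z + t *: v + (t' - t) *: v = z + t' *: v.
    by rewrite -addrA -scalerDl [t + _]addrC subrK.
  have [Ua Da] := dP _ (inball0 _ (seg a a01)).
  move=> ->; rewrite lin (derive_dirZ _ _ rs Ua) mulrC.
  by rewrite ler_wpM2l ?subr_ge0// ltW.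
have TT : 0 <= T <= T by rewrite ltW/= ?lexx.
have [t t0T rt0] : exists2 t, t \in `[0, T] & r (z + t *: v) = 0.
  apply: (@IVT R (fun t => r (z + t *: v)) 0 T 0); first exact: ltW.
    apply: derivable_within_continuous => t; rewrite in_itv /= => tT.
    have [Ut _] := dP _ (inball0 _ tT).
    by have [] := is_derive_line (smooth_is_derive v rs Ut).
  rewrite scale0r addr0 ge_min le_max (ltW rz) /=; apply/orP; right.
  have := growth 0 T (lexx _) (ltW T0) (lexx _).
  rewrite scale0r addr0 subr0 /T mulrC divfK ?gt_eqF// => H; lra.
move: t0T; rewrite in_itv /= => /andP[t0 tT].
have tpos : 0 < t.
  rewrite lt0r t0 andbT; apply/eqP => tE; move: rt0; rewrite tE scale0r addr0.
  by move=> rz0; rewrite rz0 ltxx in rz.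
exists (z + t *: v); split.
- apply: bdry_of_open => //; last by rewrite OE => -[_ /=]; rewrite rt0 ltxx.
  move=> B /nbhs_normP[e e0 eP].
  pose h := Num.min t (e / 2 / N).
  have h0 : 0 < h by rewrite lt_min tpos !divr_gt0.
  have ht : h <= t by rewrite ge_min lexx.
  have hN : h * N <= e / 2 by rewrite -ler_pdivlMr// /h ge_min lexx orbT.
  have tht : 0 <= t - h <= T by apply/andP; split; lra.
  exists (z + (t - h) *: v); split.
    rewrite OE; split; first by have [] := dP _ (inball0 _ tht).
    have /= := growth (t - h) t; rewrite rt0 => G.
    have : k * (t - (t - h)) <= 0 - r (z + (t - h) *: v) by apply: G; lra.
    have -> : t - (t - h) = h by ring.
    have := mulr_gt0 k0 h0; lra.
  apply: eP; rewrite opprD addrACA subrr add0r -scalerBl normrZ.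
  have -> : t - h - t = - h by ring.
  rewrite normrN gtr0_norm//.
  have : h * `|v| <= h * N by rewrite ler_pM2l// /N; lra.
  lra.
- have /inball : 0 <= t <= T by rewrite t0.
  by move/lt_le_trans; apply; rewrite /d ge_min lexx.
- rewrite addrC addKr normrZ gtr0_norm//.
  have -> : N / k * - r z = T * N by rewrite /T mulrC mulrA mulrAC.
  by rewrite ler_pM// /N; lra.
Unshelve. all: by end_near. Qed.

End BoundaryProjection.

(** * Forms that are nonnegative on complex tangent vectors *)

Section ComplexStructure.
Variables (R : realType) (V : normedModType R) (J : V -> V).
Hypothesis JD : forall v w, J (v + w) = J v + J w.
Hypothesis JZ : forall (k : R) v, J (k *: v) = k *: J v.
Hypothesis JJ : forall v, J (J v) = - v.
Hypothesis Jn : forall v, `|J v| = `|v|.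

(** A form that is nonnegative on the complex tangent space of [l] is, on all of
    [V], at worst as negative as the part of the vector that sticks out of that
    space.  The normal part [w] of [v] is looked for in the complex line spanned
    by a transverse vector [nu]: the two real equations [l w = l v] and
    [l (J w) = l (J v)] have determinant [l nu ^ 2 + l (J nu) ^ 2]. *)
Lemma form_ge_tangential (l : V -> R) (P : V -> V -> R) (nu : V) (k C m : R) v :
  m = 2 * `|nu| / k ->
  (forall u u', l (u + u') = l u + l u') -> (forall a u, l (a *: u) = a * l u) ->
  (forall u u' w, P (u + u') w = P u w + P u' w) ->
  (forall u w w', P u (w + w') = P u w + P u w') ->
  (forall w, l w = 0 -> l (J w) = 0 -> 0 <= P w w) ->
  0 < k -> k <= l nu -> 0 <= C ->
  (forall w, `|l w| <= C * `|w|) ->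
  (forall u w, `|P u w| <= C * (`|u| * `|w|)) ->
  - (C * m * (2 + 2 * (m * C)) * (`|l v| + `|l (J v)|) * `|v|) <= P v v.
Proof.
move=> mE lD lZ PDl PDr pc k0 kD C0 C1 C2.
move aE : (l v) => a; move bE : (l (J v)) => b.
move DE : (l nu) kD => D kD; move D'E : (l (J nu)) => D'.
have D0 : 0 < D by exact: lt_le_trans kD.
have [Q QE] : {Q | Q = D ^+ 2 + D' ^+ 2} by exists (D ^+ 2 + D' ^+ 2).
have Q0 : 0 < Q by rewrite QE ltr_pwDl ?exprn_gt0 ?sqr_ge0.
have [x xE] : {x | x = (D * a + D' * b) / Q} by eexists.
have [y yE] : {y | y = (D' * a - D * b) / Q} by eexists.
have [w wE] : {w | w = x *: nu + y *: J nu} by eexists.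
have lw : l w = a.
  rewrite wE lD !lZ DE D'E xE yE; rewrite QE in Q0 *.
  by field; rewrite gt_eqF.
have lJw : l (J w) = b.
  have -> : J w = x *: J nu + (- y) *: nu by rewrite wE JD !JZ JJ scalerN scaleNr.
  rewrite lD !lZ DE D'E xE yE; rewrite QE in Q0 *.
  by field; rewrite gt_eqF.
have lsub u u' : l (u - u') = l u - l u' by rewrite lD -scaleN1r lZ mulN1r.
have Jsub u u' : J (u - u') = J u - J u' by rewrite JD -scaleN1r JZ scaleN1r.
have pct : 0 <= P (v - w) (v - w).
  by apply: pc; rewrite ?Jsub lsub ?lw ?lJw ?aE ?bE subrr.
have m0 : 0 <= m by rewrite mE divr_ge0 ?mulr_ge0// ltW.
have DQ : D / Q <= k^-1.
  rewrite ler_pdivrMr// mulrC ler_pdivlMr// QE; have := sqr_ge0 D'.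
  have : D * k <= D ^+ 2 by rewrite expr2 ler_pM2l.
  lra.
have D'Q : `|D'| / Q <= k^-1.
  rewrite ler_pdivrMr// mulrC ler_pdivlMr// QE -[D' ^+ 2]real_normK ?num_real//.
  have := sqr_ge0 (D - `|D'|); have := normr_ge0 D'.
  move: `|D'| => h h0; nra.
have X1 : D / Q * `|a| <= k^-1 * `|a| by rewrite ler_wpM2r.
have X2 : D / Q * `|b| <= k^-1 * `|b| by rewrite ler_wpM2r.
have X3 : `|D'| / Q * `|a| <= k^-1 * `|a| by rewrite ler_wpM2r.
have X4 : `|D'| / Q * `|b| <= k^-1 * `|b| by rewrite ler_wpM2r.
have Qi : 0 <= Q^-1 by rewrite invr_ge0 ltW.
have xle : `|x| <= k^-1 * (`|a| + `|b|).
  rewrite xE normrM (ger0_norm Qi).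
  rewrite (le_trans (ler_wpM2r Qi (ler_normD _ _)))// !normrM (gtr0_norm D0).
  rewrite mulrDl mulrDr mulrAC [`|D'| * _ / Q]mulrAC; exact: lerD.
have yle : `|y| <= k^-1 * (`|a| + `|b|).
  rewrite yE normrM (ger0_norm Qi).
  rewrite (le_trans (ler_wpM2r Qi (ler_normB _ _)))// !normrM (gtr0_norm D0).
  rewrite mulrDl mulrDr mulrAC [D * _ / Q]mulrAC; exact: lerD.
have wle : `|w| <= m * (`|a| + `|b|).
  rewrite wE (le_trans (ler_normD _ _))// !normrZ Jn -mulrDl mE.
  have -> : 2 * `|nu| / k * (`|a| + `|b|) =
    (k^-1 * (`|a| + `|b|) + k^-1 * (`|a| + `|b|)) * `|nu| by ring.
  by rewrite ler_wpM2r// lerD.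
have able : `|a| + `|b| <= 2 * C * `|v|.
  by have := C1 v; have := C1 (J v); rewrite Jn aE bE; lra.
have wv : `|w| <= m * (2 * C * `|v|) by rewrite (le_trans wle)// ler_wpM2l.
(* Both error terms contain [w], hence are small with [l v] and [l (J v)]. *)
have vE : P v v = P (v - w) (v - w) + P (v - w) w + P w v.
  by rewrite -PDr subrK -PDl subrK.
have vw : `|v - w| <= `|v| + m * (2 * C * `|v|).
  by rewrite (le_trans (ler_normB _ _))// lerD2l.
have H1 : `|P (v - w) w + P w v| <=
    C * (m * (`|a| + `|b|)) * (`|v| + m * (2 * C * `|v|) + `|v|).
  rewrite (le_trans (ler_normD _ _))// mulrDr lerD//.
    rewrite (le_trans (C2 _ _))// -mulrA [_ * (`|v| + _)]mulrC ler_wpM2l//.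
    by rewrite ler_pM.
  by rewrite (le_trans (C2 _ _))// -mulrA ler_wpM2l// ler_pM.
have -> : C * m * (2 + 2 * (m * C)) * (`|a| + `|b|) * `|v| =
    C * (m * (`|a| + `|b|)) * (`|v| + m * (2 * C * `|v|) + `|v|) by ring.
by move: H1; rewrite vE ler_norml => /andP[]; lra.
Qed.

End ComplexStructure.

(** * The Levi form near the boundary *)

(** The Levi form of a real function in real terms: four times the Hermitian form
    of the complex Hessian when [J] is multiplication by i. *)
Definition levi2 (R : realType) (V : normedModType R) (J : V -> V) (f : V -> R)
    (z v : V) : R :=
  'D_v ('D_v f) z + 'D_(J v) ('D_(J v) f) z.

Section NearBoundary.
Variables (R : realType) (V : normedModType R).
Implicit Types (f g r : V -> R) (U A Omega : set V) (z v w p : V).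

(** Compactness of the closure turns constants that depend on the boundary point
    into a single one, and neighbourhoods of boundary points into a collar. *)
Lemma collar_uniform Omega U r (P : R -> V -> Prop) :
  compact (closure Omega) -> open Omega -> closure Omega `<=` U ->
  smooth_on U r -> (forall z, Omega z -> r z < 0) ->
  (forall C C' z, C <= C' -> P C z -> P C' z) ->
  (forall p, bdry Omega p -> exists C, \forall z \near p, Omega z -> P C z) ->
  exists2 C, 0 < C & forall z, Omega z -> - C^-1 < r z -> P C z.
Proof.
move=> cO oO OU rs rO Pmono Ploc.
have H : \forall C \near +oo, closure Omega `<=`
    (fun z => Omega z -> - C^-1 < r z -> P C z).
  (* At interior points the collar condition fails for large [C], so that only
   boundary points matter in the covering argument. *)
move/compact_near_coveringP: cO; apply => x cx.
  have [Ox|nOx] := pselect (Omega x); last first.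
    have [C0 HC0] := Ploc x (bdry_of_open oO cx nOx).
    exists ([set z | Omega z -> P C0 z], [set C | C0 <= C]) => /=.
      by split; [exact: HC0|apply: nbhs_pinfty_ge; exact: num_real].
    move=> [z C] /= [Pz C0C] Oz _.
    by apply: Pmono C0C _; exact: Pz.
  have rx := rO _ Ox.
  exists ([set z | r z < r x / 2], [set C | (- (r x / 2))^-1 <= C]) => /=.
    split; last by apply: nbhs_pinfty_ge; exact: num_real.
    apply: (cvgr_lt _ (smooth_continuous rs (OU _ cx))); lra.
  move=> [z C] /= [rz xC] Oz; rewrite ltNge => /negP; case.
  have t0 : 0 < - (r x / 2) by lra.
  rewrite (le_trans (ltW rz))// lerNr -[leRHS]invrK lef_pV2// posrE ?invr_gt0//.
  by rewrite (lt_le_trans _ xC)// invr_gt0.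
have [C [C0 HC]] : exists C, 0 < C /\ closure Omega `<=`
    (fun z => Omega z -> - C^-1 < r z -> P C z).
  apply: (@filter_ex _ (+oo : set_system R)); near=> C; split; near: C => //.
  exact: nbhs_pinfty_gt.
by exists C => // z Oz; apply: HC => //; exact: subset_closure.
Unshelve. all: by end_near. Qed.

Variables (I : finType) (e : I -> V) (c : V -> I -> R) (J : V -> V).
Hypothesis coordE : forall v, v = \sum_i c v i *: e i.
Hypothesis coord_le : forall v i, `|c v i| <= `|v|.
Hypothesis JD : forall v w, J (v + w) = J v + J w.
Hypothesis JZ : forall (k : R) v, J (k *: v) = k *: J v.
Hypothesis JJ : forall v, J (J v) = - v.
Hypothesis Jn : forall v, `|J v| = `|v|.

Lemma derive2_dirDr U f z v w w' : open U -> smooth_on U f -> U z ->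
  'D_v ('D_(w + w') f) z = 'D_v ('D_w f) z + 'D_v ('D_w' f) z.
Proof.
move=> oU fs Uz.
have E : \forall y \near z, 'D_(w + w') f y = ('D_w f + 'D_w' f) y.
  by apply: (open_near_eq oU Uz) => y Uy; exact: (derive_dirD _ _ oU fs Uy).
rewrite (near_eq_derive v E) deriveD//.
  exact: smooth_derivable (smooth_derive w fs) Uz.
exact: smooth_derivable (smooth_derive w' fs) Uz.
Qed.

(** By continuity of the second derivatives; the Lipschitz bounds of
    [local_bounds] make the neighbourhood independent of the direction. *)
Lemma levi2_near U f p (a : R) : open U -> smooth_on U f -> U p -> 0 < a ->
  (forall v, a * `|v| ^+ 2 <= levi2 J f p v) ->
  \forall z \near p, forall v, a / 2 * `|v| ^+ 2 <= levi2 J f z v.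
Proof.
move=> oU fs Up a0 fp.
have [d [C [d0 C0 H]]] := local_bounds coordE coord_le oU fs Up.
apply/nbhs_normP; exists (Num.min d (a / (4 * C))).
  by rewrite lt_min d0 divr_gt0// mulr_gt0.
move=> z; rewrite lt_min => /andP[zd]; rewrite ltr_pdivlMr; last exact: mulr_gt0.
move=> za v.
have pd : `|p - p| < d by rewrite subrr normr0.
have [_ _ _ /(_ z zd)[_ L]] := H p pd.
move: (L v v) (L (J v) (J v)) (fp v); rewrite Jn /levi2.
move: ('D_v _ z) ('D_v _ p) ('D_(J v) _ z) ('D_(J v) _ p) => x1 x2 y1 y2.
rewrite !ler_norml => /andP[h1 _] /andP[h2 _] h3.
have : C * (`|v| * `|v|) * `|z - p| <= a / 4 * `|v| ^+ 2.
  have -> : C * (`|v| * `|v|) * `|z - p| = (`|z - p| * (4 * C)) / 4 * `|v| ^+ 2.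
    by rewrite expr2; field.
  by rewrite ler_wpM2r ?sqr_ge0// ler_pM2r ?invr_gt0// ltW.
by move: (C * _ * _) (`|v| ^+ 2) h1 h2 h3 => u q; lra.
Qed.

(** The Levi form of a defining function is nonnegative only on complex tangent
    vectors at the boundary.  At an interior point the defect is measured by the
    depth (comparison with a boundary point at comparable distance) and by the
    complex derivative of [r] along the vector. *)
Lemma pseudoconvex_local U Omega r p0 : open U -> smooth_on U r ->
  closure Omega `<=` U -> Omega = U `&` [set z | r z < 0] ->
  (forall p, bdry Omega p -> r p = 0) ->
  (forall p, bdry Omega p -> exists v, 'D_v r p != 0) ->
  (forall p, bdry Omega p -> forall w, 'D_w r p = 0 -> 'D_(J w) r p = 0 ->
    0 <= levi2 J r p w) ->
  bdry Omega p0 ->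
  exists C, \forall z \near p0, Omega z -> forall v,
    - (C * (- r z * `|v| ^+ 2)) - C * ((`|'D_v r z| + `|'D_(J v) r z|) * `|v|)
    <= levi2 J r z v.
Proof.
move=> oU rs OU OE r0 dr pc bp0.
have Up0 : U p0 by apply: OU; case: bp0.
have [K K0 HK] := bdry_projection oU rs Up0 OE (r0 _ bp0) (dr _ bp0).
have [d [C [d0 C0 H]]] := local_bounds coordE coord_le oU rs Up0.
have [nu nuP] : exists nu, 0 < 'D_nu r p0.
  have [v vN] := dr _ bp0.
  have [|v0lt|/eqP] := ltgtP ('D_v r p0) 0; last by rewrite (negPf vN).
    exists ((-1) *: v); rewrite (derive_dirZ _ _ rs Up0); lra.
  by exists v.
have [k k0 kD] : exists2 k, 0 < k & k < 'D_nu r p0.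
  by exists ('D_nu r p0 / 2); lra.
have [d1 d10 Hd1] : exists2 d1 : R, 0 < d1 & forall y, `|y - p0| < d1 -> k < 'D_nu r y.
  by apply/nbhs_normP; exact: (cvgr_gt _ (smooth_continuous (smooth_derive nu rs) Up0)).
have [m mE] : {m | m = 2 * `|nu| / k} by eexists.
have m0 : 0 <= m by rewrite mE divr_ge0 ?mulr_ge0// ltW.
have [C' C'E] : {C' | C' = 2 * C * m * (2 + 2 * (m * (2 * C)))} by eexists.
have C'0 : 0 <= C' by rewrite C'E !(mulr_ge0, addr_ge0)// ltW.
exists (C' + 2 * C' * C * K + 2 * C * K).
have d20 : 0 < Num.min d d1 by rewrite lt_min d0.
have zd : \forall z \near p0, `|z - p0| < d by apply/nbhs_normP; exists d.
near=> z => Oz v.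
have [p [bp pd pz]] : exists p, [/\ bdry Omega p, `|p - p0| < Num.min d d1 &
    `|p - z| <= K * - r z].
  by move: Oz; near: z; exact: HK.
move: pd; rewrite lt_min => /andP[pd pd1].
have zd' : `|z - p0| < d by near: z.
have [Up B1 B2 B3] := H p pd.
have [L1 L2] := B3 z zd'.
have Q := @form_ge_tangential R V J JD JZ JJ Jn (fun w => 'D_w r p)
  (fun u w => 'D_u ('D_w r) p + 'D_(J u) ('D_(J w) r) p) nu k (2 * C) m v mE.
have {Q} : - (C' * (`|'D_v r p| + `|'D_(J v) r p|) * `|v|) <= levi2 J r p v.
  rewrite C'E; apply: Q => //.
  - by move=> u u'; exact: (derive_dirD _ _ oU rs Up).
  - by move=> a u; exact: (derive_dirZ _ _ rs Up).
  - move=> u u' w; rewrite JD.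
    have A1 := derive_dirD u u' oU (smooth_derive w rs) Up.
    have A2 := derive_dirD (J u) (J u') oU (smooth_derive (J w) rs) Up.
    by etransitivity; [exact: (f_equal2 +%R A1 A2)|exact: addrACA].
  - move=> u w w'; rewrite JD.
    have A1 := derive2_dirDr u w w' oU rs Up.
    have A2 := derive2_dirDr (J u) (J w) (J w') oU rs Up.
    by etransitivity; [exact: (f_equal2 +%R A1 A2)|exact: addrACA].
  - exact: pc.
  - by apply/ltW; exact: Hd1.
  - by rewrite mulr_ge0// ltW.
  - move=> w; rewrite (le_trans (B1 w))// -mulrA ler_peMl ?mulr_ge0 ?(ltW C0)//; lra.
  - move=> u w; rewrite (le_trans (ler_normD _ _))//.
    have := lerD (B2 u w) (B2 (J u) (J w)); rewrite !Jn => /le_trans; apply.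
    lra.
have /(_ v) M1 := L1; have /(_ (J v)) M2 := L1; rewrite Jn in M2.
have /(_ v v) M3 := L2; have /(_ (J v) (J v)) M4 := L2; rewrite Jn in M4.
move: M1 M2 M3 M4; rewrite distrC in pz.
rewrite /levi2.
move: ('D_v r z) ('D_v r p) ('D_(J v) r z) ('D_(J v) r p) => az ap bz bp'.
move: ('D_v _ z) ('D_v _ p) ('D_(J v) _ z) ('D_(J v) _ p) => x1 x2 y1 y2.
have Nn := normr_ge0 v; move: (`|v|) Nn => N N0.
set s := - r z in pz *; move: (`|z - p|) (normr_ge0 (z - p)) pz => t t0 tK.
move=> M1 M2 M3 M4 Q.
have NT : N ^+ 2 * t <= N ^+ 2 * (K * s) by rewrite ler_wpM2l// sqr_ge0.
have T0 : 0 <= N ^+ 2 * (K * s) by rewrite (le_trans _ NT)// mulr_ge0// sqr_ge0.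
have M3' : `|x1 - x2| <= C * (N ^+ 2 * (K * s)).
  by rewrite (le_trans M3)// -mulrA ler_pM2l// -expr2.
have M4' : `|y1 - y2| <= C * (N ^+ 2 * (K * s)).
  by rewrite (le_trans M4)// -mulrA ler_pM2l// -expr2.
have lip (a b : R) : `|a - b| <= C * N * t -> N * `|b| <= N * `|a| + C * (N ^+ 2 * (K * s)).
  move=> ab; have : N * `|b| <= N * (`|a| + C * N * t).
    rewrite ler_wpM2l// -lerBlDl (le_trans _ ab)// distrC; exact: lerB_dist.
  by move=> /le_trans; apply; rewrite mulrDr lerD2l; nra.
have A1 := lip az ap M1; have A2 := lip bz bp' M2.
have A3 : C' * (N * `|ap| + N * `|bp'|) <=
    C' * (N * `|az| + N * `|bz| + 2 * C * (N ^+ 2 * (K * s))).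
  by rewrite ler_wpM2l//; lra.
have A4 : 0 <= (2 * C' * C * K + 2 * C * K) * (N * `|az| + N * `|bz|).
  by rewrite mulr_ge0 ?addr_ge0 ?mulr_ge0// ltW.
have A5 : 0 <= C' * (N ^+ 2 * s).
  rewrite mulr_ge0 ?mulr_ge0 ?sqr_ge0//.
  by rewrite -(pmulr_rge0 _ K0) (le_trans t0).
move: M3' M4'; rewrite !ler_norml => /andP[m3 _] /andP[m4 _].
move: Q; have -> : C' * (`|ap| + `|bp'|) * N = C' * (N * `|ap| + N * `|bp'|) by ring.
rewrite -/s in A5 *; lra.
Unshelve. all: by end_near. Qed.

End NearBoundary.

(** * The inequality in the collar *)

Section SecondOrder.
Variables (R : realType) (V : normedModType R) (J : V -> V).
Implicit Types (f g r : V -> R) (U A Omega : set V) (z v w p : V).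

(** Four times the squared modulus of the complex derivative of [f] along [v]. *)
Definition gradsq f z v : R := ('D_v f z) ^+ 2 + ('D_(J v) f z) ^+ 2.

(** The outer function need only be twice differentiable on the values taken by
    [f], which allows powers on a half-line. *)
Lemma derive2_comp U f (h h1 h2 : R -> R) z v : open U -> smooth_on U f -> U z ->
  (forall y, U y -> is_derive (f y) 1 h (h1 (f y))) ->
  (forall y, U y -> is_derive (f y) 1 h1 (h2 (f y))) ->
  is_derive z v ('D_v (h \o f))
    (h2 (f z) * 'D_v f z ^+ 2 + h1 (f z) * 'D_v ('D_v f) z).
Proof.
move=> oU fs Uz hd h1d.
have D1 y : U y -> 'D_v (h \o f) y = h1 (f y) * 'D_v f y.
  by move=> Uy; have [_ ->] := is_derive_comp1 (smooth_is_derive v fs Uy) (hd y Uy).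
have E : {near z, (h1 \o f) * 'D_v f =1 'D_v (h \o f)}.
  by apply: (open_near_eq oU Uz) => y Uy; rewrite D1.
apply: (near_eq_is_derive E).
have F1 := is_derive_comp1 (smooth_is_derive v fs Uz) (h1d z Uz).
have F2 := smooth_is_derive v (smooth_derive v fs) Uz.
apply: (is_derive_eq (is_deriveM F1 F2)).
rewrite /GRing.scale /=; move: ('D_v ('D_v f) z) ('D_v f z) => x y; ring.
Qed.

Lemma derive2_mul U f g z v : open U -> smooth_on U f -> smooth_on U g -> U z ->
  'D_v ('D_v (f * g)) z =
    f z * 'D_v ('D_v g) z + 2 * ('D_v f z * 'D_v g z) + g z * 'D_v ('D_v f) z.
Proof.
move=> oU fs gs Uz.
have D1 y : U y -> 'D_v (f * g) y = f y * 'D_v g y + g y * 'D_v f y.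
  by move=> Uy; rewrite (deriveM (smooth_derivable v fs Uy) (smooth_derivable v gs Uy)).
have E : {near z, 'D_v (f * g) =1 f * 'D_v g + g * 'D_v f}.
  by apply: (open_near_eq oU Uz) => y Uy; rewrite D1.
rewrite (near_eq_derive v E).
have F := smooth_is_derive v fs Uz; have G := smooth_is_derive v gs Uz.
have F2 := smooth_is_derive v (smooth_derive v fs) Uz.
have G2 := smooth_is_derive v (smooth_derive v gs) Uz.
have [_ ->] := is_deriveD (is_deriveM F G2) (is_deriveM G F2).
rewrite /GRing.scale /=.
move: ('D_v ('D_v f) z) ('D_v f z) ('D_v ('D_v g) z) ('D_v g z) => x1 x2 x3 x4; ring.
Qed.

Lemma levi2_comp U f (h h1 h2 : R -> R) z v : open U -> smooth_on U f -> U z ->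
  (forall y, U y -> is_derive (f y) 1 h (h1 (f y))) ->
  (forall y, U y -> is_derive (f y) 1 h1 (h2 (f y))) ->
  levi2 J (h \o f) z v = h2 (f z) * gradsq f z v + h1 (f z) * levi2 J f z v.
Proof.
move=> oU fs Uz hd h1d; rewrite /levi2 /gradsq.
have [_ ->] := derive2_comp v oU fs Uz hd h1d.
have [_ ->] := derive2_comp (J v) oU fs Uz hd h1d.
move: ('D_v ('D_v f) z) ('D_v f z) ('D_(J v) ('D_(J v) f) z) ('D_(J v) f z).
by move=> x1 x2 x3 x4; ring.
Qed.

(** The factor exp (- psi) for psi = kappa (1 + t)^2.  The square is a cheap convex
    function whose second derivative dominates the square of the first on [0, 1]
    once multiplied by a small [kappa]. *)
Definition weight (kappa t : R) : R := expR (- (kappa * (1 + t) ^+ 2)).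

Lemma is_derive_weight (kappa t : R) : is_derive t 1 (weight kappa)
  (- (2 * kappa * (1 + t)) * weight kappa t).
Proof.
have F : is_derive t 1 (fun x : R => - (kappa * (1 + x) ^+ 2)) (- (2 * kappa * (1 + t))).
  apply: is_derive_eq; rewrite /GRing.scale /=; ring.
apply: (is_derive_eq (is_derive1_comp (is_derive_expR _) F)).
by rewrite mulrC.
Qed.

Lemma is_derive_weight2 (kappa t : R) :
  is_derive t 1 (fun t => - (2 * kappa * (1 + t)) * weight kappa t)
  (((2 * kappa * (1 + t)) ^+ 2 - 2 * kappa) * weight kappa t).
Proof.
have F := is_derive_weight kappa t.
have G : is_derive t 1 (fun x : R => - (2 * kappa * (1 + x))) (- (2 * kappa)).
  apply: is_derive_eq; rewrite /GRing.scale /=; ring.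
apply: (is_derive_eq (is_deriveM G F)).
by rewrite /GRing.scale /=; ring.
Qed.

End SecondOrder.

Section CollarAlgebra.
Variable R : realType.

(** The cross term between the derivative [a] of [r] and that of psi costs half of
    the favourable term [theta * a ^ 2 / s]; the difference of the two sides is a
    sum of two squares. *)
Lemma square_absorb (theta s a y : R) : 0 < theta < 1 -> 0 < s ->
  theta / 2 * (a ^+ 2 / s) - 2 / theta * (s * y ^+ 2) <=
  - (2 * (a * y)) - s * y ^+ 2 + theta * ((a + s * y) ^+ 2 / s).
Proof.
move=> /andP[t0 t1] s0; rewrite -subr_ge0.
have -> : - (2 * (a * y)) - s * y ^+ 2 + theta * ((a + s * y) ^+ 2 / s) -
    (theta / 2 * (a ^+ 2 / s) - 2 / theta * (s * y ^+ 2)) =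
    theta / (2 * s) * (a - 2 * (1 - theta) / theta * (s * y)) ^+ 2 +
    (3 - theta) * (s * y ^+ 2).
  by field; rewrite !gt_eqF.
apply: addr_ge0; apply: mulr_ge0; rewrite ?sqr_ge0//.
- by rewrite divr_ge0 ?mulr_ge0// ltW.
- by lra.
- by rewrite mulr_ge0 ?sqr_ge0// ltW.
Qed.

(** The error term of the pseudoconvexity estimate that is linear in the derivative
    of [r] costs the other half. *)
Lemma linear_absorb (theta s a N C : R) : 0 < theta -> 0 < s ->
  C * (`|a| * N) <= theta / 2 * (a ^+ 2 / s) + C ^+ 2 / (2 * theta) * (s * N ^+ 2).
Proof.
move=> t0 s0; rewrite -subr_ge0 -[a ^+ 2]real_normK ?num_real//.
have -> : theta / 2 * (`|a| ^+ 2 / s) + C ^+ 2 / (2 * theta) * (s * N ^+ 2) -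
    C * (`|a| * N) = theta / (2 * s) * (`|a| - C / theta * (s * N)) ^+ 2.
  by field; rewrite !gt_eqF.
by rewrite mulr_ge0 ?sqr_ge0// divr_ge0 ?mulr_ge0 ?(ltW s0) ?(ltW t0).
Qed.

(** The inequality L_rho + theta |d rho|^2 / |rho| >= 0 after division by exp (- psi).
    Here [s], [a], [b], [Lr] stand for the depth, the derivatives along [v] and
    [J v] and the Levi form of [r]; [t], [p], [q], [Ll] for the corresponding data
    of lambda, so that [k1] is the derivative of psi at [t].  What is left after
    the two absorptions is linear in [s * N ^ 2], and is beaten by a large Levi
    form of lambda. *)
Lemma collar_algebra (theta kappa s t a b p q Lr Ll N C M : R) :
  0 < theta < 1 -> kappa = theta / 16 -> 0 < s -> 0 <= t <= 1 -> 0 <= C ->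
  M * N ^+ 2 <= Ll -> 0 <= M ->
  - (C * (s * N ^+ 2)) - C * ((`|a| + `|b|) * N) <= Lr ->
  C + C ^+ 2 / theta <= 2 * kappa * M ->
  let k1 := 2 * kappa * (1 + t) in
  (0 <= Lr - 2 * (a * (k1 * p)) - 2 * (b * (k1 * q)) - s * (k1 * p) ^+ 2
    - s * (k1 * q) ^+ 2 + s * (k1 * Ll + 2 * kappa * (p ^+ 2 + q ^+ 2))
    + theta * ((a + s * (k1 * p)) ^+ 2 / s) + theta * ((b + s * (k1 * q)) ^+ 2 / s))%R.
Proof.
move=> th kE s0 t01 C0 LM M0 LrC CM.
move kkE : (2 * kappa * (1 + t)) => k1 /=.
have [th0 th1] := andP th; have [t0 t1] := andP t01.
have k0 : 0 < kappa by rewrite kE divr_gt0.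
have k1lo : 2 * kappa <= k1 by rewrite -kkE; nra.
have k1hi : k1 <= 4 * kappa by rewrite -kkE; nra.
have k1sq : 2 / theta * k1 ^+ 2 <= 2 * kappa.
  have : k1 ^+ 2 <= (4 * kappa) ^+ 2 by rewrite ler_sqr ?nnegrE; lra.
  move=> /(ler_wpM2l (_ : 0 <= 2 / theta)); rewrite divr_ge0 ?(ltW th0)// => /(_ isT).
  move=> /le_trans; apply; rewrite kE.
  have -> : 2 / theta * (4 * (theta / 16)) ^+ 2 = 2 * (theta / 16).
    by field; rewrite gt_eqF.
  by [].
have A1 := @square_absorb theta s a (k1 * p) th s0.
have A2 := @square_absorb theta s b (k1 * q) th s0.
have B1 := @linear_absorb theta s a N C th0 s0.
have B2 := @linear_absorb theta s b N C th0 s0.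
have P1 (x : R) : 2 / theta * (s * (k1 * x) ^+ 2) <= 2 * kappa * (s * x ^+ 2).
  have -> : 2 / theta * (s * (k1 * x) ^+ 2) = 2 / theta * k1 ^+ 2 * (s * x ^+ 2) by ring.
  by rewrite ler_wpM2r// mulr_ge0 ?sqr_ge0// ltW.
have Q1 := P1 p; have Q2 := P1 q.
have sN : 0 <= s * N ^+ 2 by rewrite mulr_ge0 ?sqr_ge0// ltW.
have E1 : (C + C ^+ 2 / theta) * (s * N ^+ 2) <= s * (k1 * Ll).
  rewrite (le_trans (ler_wpM2r sN CM))//.
  have -> : 2 * kappa * M * (s * N ^+ 2) = s * (2 * kappa * (M * N ^+ 2)) by ring.
  rewrite ler_pM2l// ler_pM//; first by lra.
  by rewrite mulr_ge0 ?sqr_ge0.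
have E2 : C ^+ 2 / theta = C ^+ 2 / (2 * theta) + C ^+ 2 / (2 * theta).
  by field; rewrite gt_eqF.
move: E1; rewrite E2; move: A1 A2 B1 B2 Q1 Q2.
move: (C ^+ 2 / (2 * theta)) (a ^+ 2 / s) (b ^+ 2 / s) => C' as' bs.
move: ((a + s * (k1 * p)) ^+ 2 / s) ((b + s * (k1 * q)) ^+ 2 / s) => X Y.
move: (2 / theta * _) (2 / theta * _) => Z W.
lra.
Qed.

End CollarAlgebra.

(** * A smooth function that is flat on a half-line *)

Section FlatFunction.
Variable R : realType.
Implicit Types (p q : {poly R}) (x t b c : R).

Lemma smooth1_coind (S : (R -> R) -> Prop) :
  (forall h, S h -> (forall x : R, derivable h x 1) /\ S (derive1 h)) ->
  forall h, S h -> smooth1 h.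
Proof.
move=> SP h Sh k; elim: k h Sh => [|k IH] h Sh x; first exact: (SP h Sh).1.
by rewrite derive1Sn; apply: IH; exact: (SP h Sh).2.
Qed.

Lemma smooth1_weight (kappa : R) : smooth1 (weight kappa).
Proof.
pose S (h : R -> R) := exists p, h = fun t => p.[t] * weight kappa t.
apply: (@smooth1_coind S); last by exists 1; apply/funext => t; rewrite hornerC mul1r.
move=> _ [p ->].
pose q := p^`() - p * (2 * kappa)%:P * (1 + 'X).
have D (t : R) : is_derive t 1 (fun t => p.[t] * weight kappa t) (q.[t] * weight kappa t).
  apply: (is_derive_eq (is_deriveM (is_derive_poly p t) (is_derive_weight kappa t))).
  by rewrite /q /GRing.scale /= !(hornerM, hornerD, hornerN, hornerC, hornerX); ring.
split=> [t|]; first by have [] := D t.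
by exists q; apply/funext => t; rewrite derive1E; have [_ ->] := D t.
Qed.

(** The functions p(1/x) exp(-1/x) extended by zero to the left.  Keeping the
    polynomial as a parameter makes the family stable under differentiation. *)
Definition flat p x : R := if 0 < x then p.[x^-1] * expR (- x^-1) else 0.

Lemma expn_expRN (k : nat) x : 0 <= x -> x ^+ k * expR (- x) <= k`!%:R.
Proof.
move=> x0; rewrite expRN ler_pdivrMr ?expR_gt0//.
case: k => [|k].
  rewrite expr0 mul1r; have := expR_ge1Dx x; lra.
have := expR_ge1Dxn k x0; set F := (k.+1)`!%:R => H.
have F0 : 0 < F by rewrite ltr0n fact_gt0.
have : x ^+ k.+1 / F <= expR x by lra.
by rewrite ler_pdivrMr// mulrC.
Qed.

(** Vanishing of order one at the origin suffices for differentiability there,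
    since [flat p x / x] is again a member of the family. *)
Lemma flat_bound p : exists C : R, 0 <= C /\ forall x, `|flat p x| <= C * `|x|.
Proof.
(* The power of [y] is what the induction on [p] consumes. *)
have H : forall k, exists C : R, 0 <= C /\ forall y, 0 < y ->
    `|p.[y]| * y ^+ k * expR (- y) <= C.
  elim/poly_ind: p => [|p c IH] k.
    by exists 0; split => // y y0; rewrite horner0 normr0 !mul0r.
  have [C [C0 HC]] := IH k.+1.
  exists (C + `|c| * k`!%:R); split; first by rewrite addr_ge0 ?mulr_ge0.
  move=> y y0; rewrite !hornerE.
  have A : `|p.[y] * y + c| <= `|p.[y]| * y + `|c|.
    by rewrite (le_trans (ler_normD _ _))// normrM (gtr0_norm y0).
  have e0 : 0 <= y ^+ k * expR (- y) by rewrite mulr_ge0 ?exprn_ge0 ?(ltW y0) ?expR_ge0.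
  rewrite -mulrA (le_trans (ler_wpM2r e0 A))// mulrDl lerD//.
    by rewrite (le_trans _ (HC y y0))// exprS !mulrA.
  by rewrite ler_wpM2l// expn_expRN// ltW.
have [C [C0 HC]] := H 1%N; exists C; split => // x.
rewrite /flat; case: ifPn => [x0|_]; last by rewrite normr0 mulr_ge0.
rewrite normrM (ger0_norm (expR_ge0 _)) (gtr0_norm x0) -ler_pdivrMr// mulrAC.
by apply: HC; rewrite invr_gt0.
Qed.

Lemma is_derive_flat p x : is_derive x 1 (flat p) (flat ('X ^+ 2 * (p - p^`())) x).
Proof.
have [x0|x0|x0] := ltgtP x 0.
- rewrite [flat _ x]/flat ltNge (ltW x0) /=.
  have E : \forall y \near x, (cst 0 : R -> R) y = flat p y.
    near=> y; rewrite /flat ltNge (_ : y <= 0)//.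
    by apply/ltW; near: y; exact: lt_nbhsl.
  by apply: (near_eq_is_derive E); exact: is_derive_cst.
- rewrite [flat _ x]/flat x0.
  have E : \forall y \near x, p.[y^-1] * expR (- y^-1) = flat p y.
    near=> y; rewrite /flat ifT//.
    by near: y; exact: lt_nbhsr.
  apply: (near_eq_is_derive E).
  have V : is_derive x 1 (fun y : R => y^-1) (- (x^-1 ^+ 2)).
    have := is_deriveV (lt0r_neq0 x0) (is_derive_id x 1).
    by move=> /is_derive_eq; apply; rewrite exprVn /GRing.scale /= mulr1.
  have A := is_derive1_comp (is_derive_poly p x^-1) V.
  have B := @is_derive1_comp R expR (fun y => - y^-1) x _ _
    (is_derive_expR (- x^-1)) (is_deriveN V).
  apply: (is_derive_eq (is_deriveM A B)).
  by rewrite /GRing.scale /= !(hornerM, hornerD, hornerN, hornerC, hornerX); ring.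
rewrite x0 [flat _ 0]/flat ltxx.
have E : (fun h : R => h^-1 *: ((flat p \o shift 0) (h *: 1) - flat p 0)) @ 0^' --> (0:R).
  have [C [C0 HC]] := flat_bound ('X * p).
  have E1 : \forall h \near (0:R)^', flat ('X * p) h =
      h^-1 *: ((flat p \o shift 0) (h *: 1) - flat p 0).
    near=> h; rewrite /= addr0 [h *: 1]mulr1 [flat p 0]/flat ltxx subr0.
    rewrite /flat; case: ifPn => _; last by rewrite scaler0.
    by rewrite hornerM hornerX /GRing.scale /= mulrA.
  apply: cvg_trans (near_eq_cvg E1) _.
  apply/cvgrPdist_le => eps eps0; near=> h.
  rewrite sub0r normrN (le_trans (HC h))//.
  have : `|h| <= eps / (C + 1).
    near: h; apply: (@dnbhs0_le _ R^o); rewrite divr_gt0//; lra.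
  rewrite ler_pdivlMr; last lra.
  by have := normr_ge0 h; nra.
by split; [apply/cvg_ex; exists 0|exact: cvg_lim].
Unshelve. all: by end_near. Qed.

Lemma smooth1_flat p b c : smooth1 (fun t => flat p (t + b) - c).
Proof.
pose S (h : R -> R) := exists p c, h = fun t => flat p (t + b) - c.
apply: (@smooth1_coind S); last by exists p, c.
move=> _ [{}p [{}c ->]].
have D (t : R) : is_derive t 1 (fun t => flat p (t + b) - c) (flat ('X ^+ 2 * (p - p^`())) (t + b)).
  have A := @is_derive1_comp R (flat p) (fun t => t + b) t _ _
    (is_derive_flat p (t + b)) (is_derive_shift t 1 b).
  by apply: (is_derive_eq (is_deriveB A (is_derive_cst c t 1))); rewrite mulr1 subr0.
split=> [t|]; first by have [] := D t.
exists ('X ^+ 2 * (p - p^`())), 0; apply/funext => t.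
by rewrite derive1E subr0; have [_ ->] := D t.
Qed.

End FlatFunction.

(** * The cutoff *)

Section Cutoff.
Variable R : realType.
Implicit Types (x t b : R).

Let flat0 x := flat (1 : {poly R}) x.
Let flat1 x := flat ('X ^+ 2 : {poly R}) x.
Let flat2 x := flat ('X ^+ 4 - 2%:R *: 'X ^+ 3 : {poly R}) x.

Let flat0_d x : is_derive x 1 flat0 (flat1 x).
Proof.
have := is_derive_flat 1 x.
by rewrite -{2}polyC1 derivC subr0 mulr1.
Qed.

Let flat1_d x : is_derive x 1 flat1 (flat2 x).
Proof.
have := is_derive_flat ('X ^+ 2) x.
rewrite derivXn (_ : 'X^2 * _ = 'X ^+ 4 - 2%:R *: 'X ^+ 3 :> {poly R})//.
by rewrite mulrBr -exprD scaler_nat -mulr_natr mulrA -exprSr mulr_natr.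
Qed.

Let flat0E x : 0 < x -> flat0 x = expR (- x^-1).
Proof. by move=> x0; rewrite /flat0 /flat x0 hornerC mul1r. Qed.

Let flat1E x : 0 < x -> flat1 x = x^-1 ^+ 2 * expR (- x^-1).
Proof. by move=> x0; rewrite /flat1 /flat x0 hornerXn. Qed.

Let flat2E x : 0 < x -> flat2 x = (x^-1 ^+ 2 - 2 * x^-1) * flat1 x.
Proof.
move=> x0; rewrite flat1E// /flat2 /flat x0.
by rewrite hornerD hornerN hornerZ !hornerXn; ring.
Qed.

Let flat_le0 (p : {poly R}) x : x <= 0 -> flat p x = 0.
Proof. by move=> x0; rewrite /flat ltNge x0. Qed.

Let flat0_lt x y : x < y -> 0 < y -> flat0 x < flat0 y.
Proof.
move=> xy y0; rewrite (flat0E y0).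
have [x0|x0] := leP x 0; first by rewrite /flat0 flat_le0// expR_gt0.
by rewrite flat0E// ltr_expR ltrN2 ltf_pV2.
Qed.

Let flat0_le x y : x <= y -> flat0 x <= flat0 y.
Proof.
move=> xy; have [y0|y0] := leP y 0.
  by rewrite /flat0 !flat_le0// (le_trans xy).
by move: xy; rewrite le_eqVlt => /orP[/eqP->//|xy]; rewrite ltW// flat0_lt.
Qed.

Let flat1_ge0 x : 0 <= flat1 x.
Proof.
have [x0|x0] := leP x 0; first by rewrite /flat1 flat_le0.
by rewrite flat1E// mulr_ge0 ?sqr_ge0 ?expR_ge0.
Qed.

(** Differential inequality for the cutoff E(t + b) - E(b), where E = exp(-1/x) and
    x = t + b.  When |t| = b - x is at least 2 b^2 theta, the convexity of E alone suffices, because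
    E'' / E' is at least 1 / (2 b^2).  When |t| is below 2 b^2 theta, E' is
    almost constant on [x, b], and the term with E'^2 suffices; the factor 5 leaves room for
    the variation of E'. *)
Lemma flat_cutoff_ge (theta b x : R) : 0 < theta -> theta < 1 / 5 ->
  0 < b -> b <= 1 / 4 -> 0 < x -> x < b ->
  theta * ((flat0 b - flat0 x) * flat1 x) <=
  (b - x) * ((flat0 b - flat0 x) * flat2 x + 5 * theta * flat1 x ^+ 2).
Proof.
move=> t0 t1 b0 b1 x0 xb.
have bx : 0 < b - x by lra.
have f0 : 0 <= flat0 b - flat0 x by rewrite subr_ge0 flat0_le// ltW.
have xi : b^-1 <= x^-1 by rewrite lef_pV2 ?posrE// ltW.
have xi4 : 4 <= x^-1.
  by rewrite (le_trans _ xi)// -[4]invrK lef_pV2 ?posrE ?invr_gt0//; lra.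
have f2 : b^-1 ^+ 2 / 2 * flat1 x <= flat2 x.
  rewrite flat2E// ler_wpM2r//.
  have : b^-1 ^+ 2 <= x^-1 ^+ 2 by rewrite ler_sqr ?nnegrE ?invr_ge0 ?(ltW b0) ?(ltW x0).
  move: (b^-1) (x^-1) xi4 => B X; nra.
have f2' : 0 <= flat2 x.
  by rewrite (le_trans _ f2)// mulr_ge0// divr_ge0 ?sqr_ge0.
(* The threshold balances the bound on E'' / E' against [theta / (b - x)]. *)
have [far|close] := leP (2 * b ^+ 2 * theta) (b - x).
  have A : theta * ((flat0 b - flat0 x) * flat1 x) <=
      (b - x) * ((flat0 b - flat0 x) * flat2 x).
    have : (2 * b ^+ 2 * theta) * ((flat0 b - flat0 x) * (b^-1 ^+ 2 / 2 * flat1 x)) <=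
      (b - x) * ((flat0 b - flat0 x) * flat2 x).
      apply: ler_pM => //; last by rewrite ler_wpM2l.
        by apply: mulr_ge0; [rewrite mulr_ge0 ?sqr_ge0|exact: ltW].
      by apply: mulr_ge0 => //; apply: mulr_ge0 => //; rewrite divr_ge0 ?sqr_ge0.
    apply: le_trans; rewrite le_eqVlt; apply/orP; left; apply/eqP.
    by move: (flat0 b - flat0 x) (flat1 x) => u w; field; rewrite gt_eqF.
  rewrite (le_trans A)// ler_pM2l// lerDl !mulr_ge0 ?sqr_ge0//; exact: ltW.
have [xi0 xi0P E] : exists2 s, s \in `[x, b] & flat0 b - flat0 x = flat1 s * (b - x).
  apply: (@MVT_segment R flat0 flat1 x b (ltW xb)) => [y _|]; first exact: flat0_d.
  by apply: derivable_within_continuous => y _; have [] := flat0_d y.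
move: xi0P; rewrite in_itv /= => /andP[s1 s2].
have s0 : 0 < xi0 by exact: lt_le_trans s1.
have x2 : b / 2 <= x.
  have : b * (b * theta) <= b * (1 / 4) by rewrite ler_pM2l//; nra.
  by rewrite expr2 -mulrA in close; lra.
have gap : x^-1 - xi0^-1 <= 4 * theta.
  have : x^-1 - b^-1 <= 4 * theta.
    have -> : x^-1 - b^-1 = (b - x) / (x * b) by field; rewrite !gt_eqF.
    rewrite ler_pdivrMr ?mulr_gt0//.
    have : b / 2 * b <= x * b by rewrite ler_pM2r.
    move=> /(ler_wpM2l (ltW t0)); lra.
  have : b^-1 <= xi0^-1 by rewrite lef_pV2 ?posrE.
  lra.
have K : (1 - 4 * theta) * flat1 xi0 <= flat1 x.
  rewrite !flat1E//.
  have e1 : (1 - 4 * theta) * expR (- xi0^-1) <= expR (- x^-1).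
    have -> : - x^-1 = - (x^-1 - xi0^-1) + - xi0^-1 by ring.
    rewrite expRD ler_pM2r ?expR_gt0// (le_trans _ (expR_ge1Dx _))//; lra.
  have e2 : xi0^-1 ^+ 2 <= x^-1 ^+ 2.
    rewrite ler_sqr ?nnegrE ?invr_ge0 ?(ltW s0) ?(ltW x0)//.
    by rewrite lef_pV2 ?posrE.
  have -> : (1 - 4 * theta) * (xi0^-1 ^+ 2 * expR (- xi0^-1)) =
    xi0^-1 ^+ 2 * ((1 - 4 * theta) * expR (- xi0^-1)) by ring.
  apply: ler_pM => //; first exact: sqr_ge0.
  by rewrite mulr_ge0 ?expR_ge0//; lra.
have K' : flat1 xi0 <= 5 * flat1 x by have := flat1_ge0 xi0; nra.
rewrite E in f0 *.
have -> : theta * (flat1 xi0 * (b - x) * flat1 x) =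
   (b - x) * (theta * (flat1 xi0 * flat1 x)) by ring.
rewrite ler_pM2l//.
have : 0 <= flat1 xi0 * (b - x) * flat2 x by rewrite mulr_ge0.
have : theta * (flat1 xi0 * flat1 x) <= theta * (5 * flat1 x * flat1 x).
  by rewrite ler_pM2l// ler_wpM2r.
rewrite expr2; lra.
Qed.

(** A smooth change of the defining function that makes it constant at depth
    beyond [b].  [P1] and [P2] are the first two derivatives of
    Phi(s) = - (- h s)^(1 - 5 theta), and the last clause says that composing with
    Phi preserves plurisubharmonicity when the inner function satisfies the
    inequality with exponent 1 - theta. *)
Lemma cutoff (theta b : R) : 0 < theta -> theta < 1 / 5 -> 0 < b -> b <= 1 / 4 ->
  exists h P1 P2 : R -> R,
    [/\ smooth1 h, h 0 = 0, 0 < derive1 h 0,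
        (forall t, (h t < 0) = (t < 0)) &
        forall t, t < 0 ->
        [/\ is_derive t 1 (fun s => - ((- h s) `^ (1 - 5 * theta))) (P1 t),
            is_derive t 1 P1 (P2 t), 0 <= P1 t,
            t <= - b -> P1 t = 0 /\ P2 t = 0 &
            - b < t -> theta * P1 t <= P2 t * - t]].
Proof.
move=> t0 t1 b0 b1.
pose h t := flat0 (t + b) - flat0 b.
pose eta := 1 - 5 * theta.
have hd t : is_derive t 1 h (flat1 (t + b)).
  have A := @is_derive1_comp R flat0 (fun t => t + b) t _ _
    (flat0_d (t + b)) (is_derive_shift t 1 b).
  by apply: (is_derive_eq (is_deriveB A (is_derive_cst (flat0 b) t 1))); rewrite mulr1 subr0.
have hd2 t : is_derive t 1 (fun t => flat1 (t + b)) (flat2 (t + b)).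
  have A := @is_derive1_comp R flat1 (fun t => t + b) t _ _
    (flat1_d (t + b)) (is_derive_shift t 1 b).
  by apply: (is_derive_eq A); rewrite mulr1.
pose P1 t := eta * (- h t) `^ (eta - 1) * flat1 (t + b).
pose P2 t := eta * (- h t) `^ (eta - 1) * flat2 (t + b) +
  eta * (1 - eta) * (- h t) `^ (eta - 2) * flat1 (t + b) ^+ 2.
have hneg t : t < 0 -> h t < 0.
  by move=> tn; rewrite /h subr_lt0 flat0_lt//; lra.
exists h, P1, P2; split.
- exact: smooth1_flat.
- by rewrite /h add0r subrr.
- rewrite derive1E; have [_ ->] := hd 0; rewrite add0r flat1E//.
  by rewrite mulr_gt0 ?expR_gt0// exprn_gt0// invr_gt0.
- move=> t; have [/hneg //|tp] := ltP t 0.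
  by apply/negbTE; rewrite -leNgt /h subr_ge0 flat0_le//; lra.
move=> t tn; have hp : 0 < - h t by rewrite oppr_gt0 hneg.
have pd (a : R) : is_derive t 1 (fun s => (- h s) `^ a)
    (- (a * (- h t) `^ (a - 1) * flat1 (t + b))).
  have A := @is_derive1_comp R (fun x => x `^ a) (fun s => - h s) t _ _
    (is_derive1_powR a hp) (is_deriveN (hd t)).
  by apply: (is_derive_eq A); rewrite mulrN.
split.
- by apply: (is_derive_eq (is_deriveN (pd eta))); rewrite opprK.
- have A := is_deriveM (is_deriveZ eta (pd (eta - 1))) (hd2 t).
  apply: (is_derive_eq A).
  have -> : eta - 1 - 1 = eta - 2 by ring.
  rewrite /GRing.scale /= /P2.
  rewrite /GRing.scale /=.
  move: ((- h t) `^ (eta - 1)) ((- h t) `^ (eta - 2)) (flat1 _) (flat2 _) => x y z w.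
  ring.
- by rewrite /P1 mulr_ge0 ?mulr_ge0 ?powR_ge0//; rewrite /eta; lra.
- move=> tb; rewrite /P1 /P2.
  have -> : flat1 (t + b) = 0 by rewrite /flat1 flat_le0//; lra.
  have -> : flat2 (t + b) = 0 by rewrite /flat2 flat_le0//; lra.
  by rewrite expr0n !mulr0 addr0.
- move=> tb.
  have x0 : 0 < t + b by lra.
  have xb : t + b < b by lra.
  have := flat_cutoff_ge t0 t1 b0 b1 x0 xb.
  have -> : flat0 b - flat0 (t + b) = - h t by rewrite /h opprB.
  have -> : b - (t + b) = - t by ring.
  move=> K.
  have powS : (- h t) `^ (eta - 1) = (- h t) `^ (eta - 2) * - h t.
    have -> : eta - 1 = eta - 2 + 1 by ring.
    rewrite powRD; first by rewrite powRr1// ltW.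
    by apply/implyP => _; rewrite gt_eqF.
  rewrite /P1 /P2 powS.
  have W0 : 0 <= eta * (- h t) `^ (eta - 2).
    by rewrite mulr_ge0 ?powR_ge0//; rewrite /eta; lra.
  have -> : 1 - eta = 5 * theta by rewrite /eta; ring.
  move: (ler_wpM2l W0 K).
  move: ((- h t) `^ (eta - 2)) (- h t) (flat1 (t + b)) (flat2 (t + b)) => w H x y.
  lra.
Qed.

End Cutoff.

(** * Subharmonicity of functions with nonnegative Laplacian *)

Section MaximumPrinciple.
Variable R : realType.

(** If the second derivative were positive, the first one, which vanishes at the
    maximum, would be positive just after it. *)
Lemma second_derivative_at_max (V : normedModType R) (g : V -> R) z v :
  (\forall y \near z, derivable g y v) -> derivable ('D_v g) z v ->
  (\forall y \near z, g y <= g z) -> 'D_v ('D_v g) z <= 0.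
Proof.
move=> gd gd2 gmax; rewrite leNgt; apply/negP => d0.
have near_line (P : V -> Prop) : (\forall y \near z, P y) ->
    exists2 e : R, 0 < e & forall s : R, `|s| < e -> P (z + s *: v).
  move/nbhs_normP => [e e0 eP]; exists (e / (`|v| + 1)).
    by rewrite divr_gt0// ltr_wpDl.
  move=> s; rewrite ltr_pdivlMr ?ltr_wpDl// => se; apply: eP.
  rewrite addrC addKr normrZ (le_lt_trans _ se)// ler_wpM2l// lerDl//.
have [e1 e10 gd'] := near_line _ gd.
have [e2 e20 gmax'] := near_line _ gmax.
have fd (s : R) : `|s| < e1 ->
    is_derive s 1 (fun s : R => g (z + s *: v)) ('D_v g (z + s *: v)).
  by move=> /gd' h; apply: is_derive_line; exact: derivableP.
have e0 : 0 < Num.min e1 e2 by rewrite lt_min e10.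
have abs_lt (s : R) : s \in `]- Num.min e1 e2, Num.min e1 e2[ -> `|s| < e1 /\ `|s| < e2.
  by rewrite in_itv /= -ltr_norml lt_min => /andP.
have psi0 : 'D_v g z = 0.
  have H : is_derive (0 : R) 1 (fun s : R => g (z + s *: v)) 0.
    apply: (@derive1_at_max R _ (- Num.min e1 e2) (Num.min e1 e2)).
    - lra.
    - by move=> t /abs_lt[t1 _]; have [] := fd t t1.
    - by rewrite in_itv /= oppr_lt0 e0.
    - by move=> t /abs_lt[_ t2]; rewrite scale0r addr0; exact: gmax'.
  have := fd 0; rewrite normr0 => /(_ e10) [_]; rewrite scale0r addr0 => <-.
  by have [_ ->] := H.
have psid : is_derive (0 : R) 1 (fun s : R => 'D_v g (z + s *: v)) ('D_v ('D_v g) z).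
  have H : is_derive (z + (0 : R) *: v) v ('D_v g) ('D_v ('D_v g) z).
    by rewrite scale0r addr0; exact: derivableP.
  exact: (is_derive_line H).
have [e3 e30 pos] : exists2 e : R, 0 < e & forall s : R, 0 < s -> s < e ->
    0 < 'D_v g (z + s *: v).
  have [psic psiE] := psid.
  have /cvgr_gt /(_ 0 d0) : (fun h : R => h^-1 *: (((fun s : R => 'D_v g (z + s *: v)) \o shift 0)
      (h *: 1) - 'D_v g (z + 0 *: v))) @ 0^' --> 'D_v ('D_v g) z.
    by rewrite -psiE; exact: psic.
  move=> /nbhs_ballP[e /= ee He]; exists e; first exact: ee.
  move=> s s0 se; have si : 0 < s^-1 by rewrite invr_gt0.
  have := He s; rewrite /ball /= sub0r normrN (gtr0_norm s0) => /(_ se (lt0r_neq0 s0)).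
  rewrite addr0 scale0r addr0 psi0 subr0 [s *: 1]mulr1.
  by rewrite -[_ *: _]/(_ * _) (pmulr_rgt0 _ si); exact.
pose s := Num.min (Num.min e1 e2) e3 / 2.
have s0 : 0 < s by rewrite divr_gt0// lt_min e0.
have [s1 s2 s3] : [/\ s < e1, s < e2 & s < e3].
  have sm : s < Num.min (Num.min e1 e2) e3.
    by rewrite /s; move: s0; rewrite /s; lra.
  by move: sm; rewrite !lt_min => /andP[/andP[-> ->] ->].
have [||c] := @MVT R (fun s => g (z + s *: v)) (fun s => 'D_v g (z + s *: v)) 0 s s0.
- move=> t; rewrite in_itv /= => /andP[t0 ts]; apply: fd.
  by rewrite gtr0_norm// (lt_trans ts).
- apply: derivable_within_continuous => t; rewrite in_itv /= => /andP[t0 ts].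
  have [] // := fd t _; first by rewrite ger0_norm// (le_lt_trans ts).
rewrite in_itv /= scale0r addr0 subr0 => /andP[c0 cs] E.
have := gmax' s; rewrite gtr0_norm// => /(_ s2).
rewrite -subr_le0 E leNgt mulr_gt0//.
by apply: pos => //; exact: lt_trans s3.
Qed.

Local Notation P2 := (R * R)%type.
Local Notation e1 := ((1 : R), (0 : R)).
Local Notation e2 := ((0 : R), (1 : R)).

Definition sqdist (t : P2) : R := t.1 ^+ 2 + t.2 ^+ 2.

Lemma is_derive_sqdist (t v : P2) :
  is_derive t v sqdist (2 * t.1 * v.1 + 2 * t.2 * v.2).
Proof.
have D1 : is_derive t v (fst : P2 -> R) v.1 by apply: is_derive_linear.
have D2 : is_derive t v (snd : P2 -> R) v.2 by apply: is_derive_linear.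
apply: (is_derive_eq (is_deriveD (is_deriveX 2 D1) (is_deriveX 2 D2))).
by rewrite /GRing.scale /= !expr1; ring.
Qed.

Lemma derive2_sqdist (t v : P2) :
  is_derive t v ('D_v sqdist) (2 * v.1 ^+ 2 + 2 * v.2 ^+ 2).
Proof.
have -> : 'D_v sqdist = (2 * v.1) *: (fst : P2 -> R) + (2 * v.2) *: (snd : P2 -> R).
  apply/funext => y; have [_ ->] := is_derive_sqdist y v.
  by rewrite !fctE /GRing.scale /=; ring.
have D1 : is_derive t v (fst : P2 -> R) v.1 by apply: is_derive_linear.
have D2 : is_derive t v (snd : P2 -> R) v.2 by apply: is_derive_linear.
apply: (is_derive_eq (is_deriveD (is_deriveZ _ D1) (is_deriveZ _ D2))).
by rewrite /GRing.scale /=; ring.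
Qed.

(** If [u] exceeded a harmonic majorant somewhere, a small multiple of the
    squared distance could be added to [u - h] so that the sum has an interior
    maximum, where its Laplacian would be both positive and nonpositive. *)
Lemma subharmonic_C2 (D : set P2) (u : P2 -> R) : open D ->
  (forall t, D t -> {for t, continuous u}) ->
  (forall t v, D t -> derivable u t v) ->
  (forall t v, D t -> derivable ('D_v u) t v) ->
  (forall t, D t -> 0 <= 'D_e1 ('D_e1 u) t + 'D_e2 ('D_e2 u) t) ->
  subharmonic_on D u.
Proof.
move=> oD uc ud ud2 ul; split.
  move=> t Dt a ua; near=> y => _; near: y.
  exact: (cvgr_lt (u t) (uc t Dt)).
move=> K h cK KD hc [hs hl] uh t Kt; rewrite leNgt; apply/negP => hu.
have K0 : K !=set0 by exists t.
have sqc : continuous sqdist.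
  have l1 : smooth_on setT (fst : P2 -> R).
    by apply: smooth_linear => //; [exact: openT|move=> v; rewrite prod_normE le_max lexx].
  have l2 : smooth_on setT (snd : P2 -> R).
    by apply: smooth_linear => //; [exact: openT|move=> v; rewrite prod_normE le_max lexx orbT].
  have -> : sqdist = (fst : P2 -> R) * (fst : P2 -> R) + (snd : P2 -> R) * (snd : P2 -> R).
    by apply/funext => y; rewrite /sqdist !expr2.
  have S : smooth_on setT ((fst : P2 -> R) * (fst : P2 -> R) +
      (snd : P2 -> R) * (snd : P2 -> R)).
    by apply: smooth_add; [exact: openT| |]; apply: smooth_mul => //; exact: openT.
  by move=> y; exact: (smooth_continuous S I).
have [m _ mP] := compact_EVT_max K0 cK (continuous_subspaceT sqc).
(* Small enough for the added term not to compensate the excess on [K]. *)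
pose eps := (u t - h t) / (2 * (sqdist m + 1)).
have sq0 y : 0 <= sqdist y by rewrite addr_ge0// sqr_ge0.
have eps0 : 0 < eps by rewrite divr_gt0 ?subr_gt0// mulr_gt0// ltr_wpDl.
have epsK y : K y -> eps * sqdist y < (u t - h t).
  move=> Ky; have : sqdist y <= sqdist m by apply: mP; rewrite inE.
  have ut : 0 < u t - h t by rewrite subr_gt0.
  rewrite /eps mulrAC ltr_pdivrMr; last by rewrite mulr_gt0// ltr_wpDl.
  move=> ym; rewrite ltr_pM2l//; have := sq0 m; lra.
pose w := u - h + eps *: sqdist.
have wc : {within K, continuous w}.
  apply: within_continuousD; first apply: within_continuousB => //.
    by apply: continuous_in_subspaceT => y; rewrite inE => /KD; exact: uc.
  by apply: continuous_subspaceT => y; apply: cvgZr; exact: sqc.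
have [c cK' cmax] := compact_EVT_max K0 cK wc.
rewrite inE in cK'.
have hsm := hs.
have wt : u t - h t <= w c.
  have : w t <= w c by apply: cmax; rewrite inE.
  apply: le_trans; rewrite /w !fctE lerDl.
  by rewrite -[_ *: _]/(_ * _) mulr_ge0// ltW.
have ci : K^°%classic c.
  apply: contrapT => nci.
  have bc : bdry K c by split => //; exact: subset_closure.
  have := uh c bc; have := epsK c cK'; move: wt.
  by rewrite /w !fctE -[_ *: _]/(_ * _); lra.
have oKi : open K^°%classic by exact: open_interior.
have Di y : K^° y -> D y by move=> /interior_subset /KD.
have lap v : 'D_v ('D_v u) c - 'D_v ('D_v h) c + eps * (2 * v.1 ^+ 2 + 2 * v.2 ^+ 2) <= 0.
  have D1 y : K^° y -> is_derive y v w ('D_v u y - 'D_v h y + eps * 'D_v sqdist y).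
    move=> Ky; have U := derivableP (ud y v (Di y Ky)).
    have H : is_derive y v h ('D_v h y).
      by apply: derivableP; have [_ /(_ isT v)] := hs [::] y isT Ky.
    have S := derivableP (@ex_derive _ _ _ _ _ _ _ (is_derive_sqdist y v)).
    exact: (is_deriveD (is_deriveB U H) (is_deriveZ eps S)).
  have E : {near c, 'D_v u - 'D_v h + eps *: 'D_v sqdist =1 'D_v w}.
    by apply: (open_near_eq oKi ci) => y Ky; have [_ ->] := D1 y Ky.
  have W : is_derive c v ('D_v w)
      ('D_v ('D_v u) c - 'D_v ('D_v h) c + eps * (2 * v.1 ^+ 2 + 2 * v.2 ^+ 2)).
    refine (near_eq_is_derive E _).
    have U := derivableP (ud2 c v (Di c ci)).
    have H : is_derive c v ('D_v h) ('D_v ('D_v h) c).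
      by apply: derivableP; have [_ /(_ isT v)] := hs [:: v] c isT ci.
    exact: (is_deriveD (is_deriveB U H) (is_deriveZ eps (derive2_sqdist c v))).
  have [Wd <-] := W; apply: second_derivative_at_max => //.
    by near=> y; have [] // := D1 y _; near: y; exact: open_nbhs_nbhs.
  near=> y; apply: cmax; rewrite inE; apply: interior_subset.
  by near: y; exact: open_nbhs_nbhs.
have := lap e1; have := lap e2; have := ul c (Di c ci); have := hl c ci.
rewrite /= !expr1n !expr0n /=.
have final (a b a' b' : R) : a' + b' = 0 -> 0 <= a + b ->
    b - b' + eps * (2 * 0 + 2 * 1) <= 0 -> a - a' + eps * (2 * 1 + 2 * 0) <= 0 -> False.
  by lra.
exact: final.
Unshelve. all: by end_near. Qed.

End MaximumPrinciple.

(** * Complex space in real coordinates *)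

Section ComplexSpace.
Variables (R : realType) (n : nat).
Local Notation V := (Cn R n).
Implicit Types (f g : V -> R) (U A : set V) (z v w : V).

Definition Jc v : V := (- v.2, v.1).

Definition Cn_basis (i : 'I_n + 'I_n) : V :=
  match i with inl j => (delta_mx 0 j, 0) | inr j => (0, delta_mx 0 j) end.

Definition Cn_coord v (i : 'I_n + 'I_n) : R :=
  match i with inl j => v.1 0 j | inr j => v.2 0 j end.

Lemma Cn_coordE v : v = \sum_i Cn_coord v i *: Cn_basis i.
Proof.
rewrite big_sumType /=.
have E1 : \sum_j v.1 0 j *: (delta_mx 0 j, 0) = (v.1, 0) :> V.
  rewrite [in RHS](row_sum_delta v.1).
  apply: (big_ind2 (fun (x : V) y => x = (y, 0))) => //.
    by move=> x1 x2 y1 y2 -> ->; congr (_, _); rewrite addr0.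
  by move=> j _; congr (_, _); rewrite scaler0.
have E2 : \sum_j v.2 0 j *: (0, delta_mx 0 j) = (0, v.2) :> V.
  rewrite [in RHS](row_sum_delta v.2).
  apply: (big_ind2 (fun (x : V) y => x = (0, y))) => //.
    by move=> x1 x2 y1 y2 -> ->; congr (_, _); rewrite addr0.
  by move=> j _; congr (_, _); rewrite scaler0.
rewrite E1 E2 [LHS]surjective_pairing.
by congr (_, _); rewrite ?addr0 ?add0r.
Qed.

Lemma Cn_coord_le v i : `|Cn_coord v i| <= `|v|.
Proof.
rewrite prod_normE le_max; apply/orP; case: i => j /=; [left|right].
  rewrite {2}/Num.Def.normr /= mx_normrE.
  by apply/bigmax_geP; right; exists (0, j).
rewrite {2}/Num.Def.normr /= mx_normrE.
by apply/bigmax_geP; right; exists (0, j).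
Qed.

Lemma JcD v w : Jc (v + w) = Jc v + Jc w.
Proof. by rewrite /Jc; congr (_, _); rewrite opprD. Qed.

Lemma JcZ (k : R) v : Jc (k *: v) = k *: Jc v.
Proof. by rewrite /Jc; congr (_, _); rewrite scalerN. Qed.

Lemma JcJc v : Jc (Jc v) = - v.
Proof. by case: v. Qed.

Lemma norm_Jc v : `|Jc v| = `|v|.
Proof. by rewrite !prod_normE /= normrN maxC. Qed.

Lemma complex_lineE z v (t : R * R) :
  complex_line z v t = z + (t.1 *: v + t.2 *: Jc v).
Proof.
rewrite /complex_line; congr (_, _) => /=.
  by rewrite scalerN.
by rewrite addrC [_ + t.2 *: v.1]addrC addrC.
Qed.

Lemma complex_line_shift z v (t d : R * R) (s : R) :
  complex_line z v (t + s *: d) =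
  complex_line z v t + s *: (d.1 *: v + d.2 *: Jc v).
Proof.
rewrite !complex_lineE /= -addrA; congr (_ + _).
by rewrite scalerDr !scalerDl !scalerA addrACA.
Qed.

Lemma complex_line_continuous z v : continuous (complex_line z v).
Proof.
have -> : complex_line z v = (fun t => z + (t.1 *: v + t.2 *: Jc v)).
  by apply/funext => t; rewrite complex_lineE.
move=> t; apply: cvgD; first exact: cvg_cst.
by apply: cvgD; apply: cvgZr_tmp; [exact: cvg_fst|exact: cvg_snd].
Qed.

Lemma derive_complex_line (f : V -> R) z v (t d : R * R) :
  (fun h : R => h^-1 *: (((f \o complex_line z v) \o shift t) (h *: d) -
     (f \o complex_line z v) t)) =
  (fun h : R => h^-1 *: ((f \o shift (complex_line z v t))
     (h *: (d.1 *: v + d.2 *: Jc v)) - f (complex_line z v t))).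
Proof.
apply/funext => h /=; rewrite [h *: d + t]addrC complex_line_shift.
by rewrite [complex_line z v t + _]addrC.
Qed.

(** A function with two derivatives along every line and nonnegative Levi form is
    plurisubharmonic: on a complex line its Laplacian is the Levi form. *)
Lemma psh_levi2 U f : open U ->
  (forall z, U z -> {for z, continuous f}) ->
  (forall z v, U z -> derivable f z v) ->
  (forall z v, U z -> derivable ('D_v f) z v) ->
  (forall z v, U z -> 0 <= levi2 Jc f z v) ->
  psh_on U f.
Proof.
move=> oU fc fd fd2 fl; split.
  move=> z Uz a fa; near=> y => _; near: y.
  exact: (cvgr_lt (f z) (fc z Uz)).
move=> z v.
have dE (g : V -> R) d : 'D_d (g \o complex_line z v) =
    ('D_(d.1 *: v + d.2 *: Jc v) g) \o complex_line z v.
  by apply/funext => t; rewrite /derive derive_complex_line.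
have dE1 (g : V -> R) : 'D_((1, 0) : R * R) (g \o complex_line z v) =
    ('D_v g) \o complex_line z v.
  by rewrite dE /= scale1r scale0r addr0.
have dE2 (g : V -> R) : 'D_((0, 1) : R * R) (g \o complex_line z v) =
    ('D_(Jc v) g) \o complex_line z v.
  by rewrite dE /= scale1r scale0r add0r.
apply: subharmonic_C2.
- by apply: open_comp => // t _; exact: complex_line_continuous.
- move=> t Ut; apply: continuous_comp; first exact: complex_line_continuous.
  exact: fc.
- by move=> t d Ut; rewrite /derivable derive_complex_line; exact: fd.
- move=> t d Ut; rewrite (dE f d) /derivable.
  by rewrite (derive_complex_line ('D_(d.1 *: v + d.2 *: Jc v) f)); exact: fd2.
move=> t Ut; have := fl _ v Ut; rewrite (dE1 f) (dE2 f).
have H1 := congr1 (@^~ t) (dE1 ('D_v f)); have H2 := congr1 (@^~ t) (dE2 ('D_(Jc v) f)).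
by rewrite (f_equal2 +%R H1 H2).
Unshelve. all: by end_near. Qed.

(** The norm of a pair is the maximum of the two norms, so a bounded set lies in a
    product of two balls of real row vectors, which the Heine-Borel theorem makes
    compact. *)
Lemma closure_compact (A : set V) : bounded_set A -> compact (closure A).
Proof.
move=> [M [Mr HM]].
have AB : A `<=` [set z | `|z| <= M + 1] by move=> z Az; apply: HM => //; rewrite ltrDl.
pose B := [set x : 'rV[R]_n | `|x| <= M + 1].
have cB : compact B.
  apply: bounded_closed_compact.
    exists (M + 1); split; first exact: num_real.
    by move=> x Mx y; rewrite /B /= => yM; apply: le_trans (ltW Mx).
  have -> : B = (fun x => `|x|) @^-1` [set x | x <= M + 1] by [].
  apply: closed_comp; last exact: closed_le.
  by move=> x _; exact: norm_continuous.
have cBB : compact (B `*` B) by exact: compact_setX.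
apply: (@subclosed_compact _ _ (B `*` B)) => //; first exact: closed_closure.
have clB : closed (B `*` B).
  by apply: compact_closed => //; exact: norm_hausdorff.
rewrite closureE => z; apply; split => // y /AB /=.
by rewrite prod_normE ge_max => /andP[].
Qed.

End ComplexSpace.

(** * The Levi form in real coordinates *)

Section LeviForm.
Variables (R : realType) (n : nat).
Local Notation V := (Cn R n).
Implicit Types (f g : V -> R) (U A : set V) (z v w : V).
Local Open Scope complex_scope.

Definition cvec v : 'rV[R[i]]_n := \row_j (v.1 0 j +i* v.2 0 j).

Let X (j : 'I_n) : V := (delta_mx 0 j, 0).
Let Y (j : 'I_n) : V := (0, delta_mx 0 j).

Let halfC (a b : R) : (a +i* b) / 2%:R = (a / 2) +i* (b / 2) :> R[i].
Proof.
have -> : (2%:R : R[i]) = (2%:R : R)%:C by rewrite rmorph_nat.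
rewrite -fmorphV /=; apply/eqP; rewrite eq_complex /=.
by rewrite !mulr0 !subr0 !add0r !eqxx.
Qed.

Let iC (a b : R) : (0 +i* 1) * (a +i* b) = (- b) +i* a :> R[i].
Proof. by apply/eqP; rewrite eq_complex /= !mul0r !mul1r sub0r add0r !eqxx. Qed.

(** Common form of the two Wirtinger derivatives ([s] = -1 or 1) of a function whose
    real and imaginary parts have derivatives [a], [b] along x and [c], [d] along y. *)
Definition wirtinger (s a b c d : R) : R[i] :=
  ((a +i* b) + s%:C * ((0 +i* 1) * (c +i* d))) / 2%:R.

Lemma wirtingerE (s a b c d : R) :
  wirtinger s a b c d = ((a - s * d) / 2) +i* ((b + s * c) / 2).
Proof.
rewrite /wirtinger iC -[_%:C * _]/((s * (- d) - 0 * c) +i* (s * c + 0 * (- d))).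
rewrite -[_ + _]/((a + (s * (- d) - 0 * c)) +i* (b + (s * c + 0 * (- d)))) halfC.
by rewrite !mul0r subr0 addr0 mulrN.
Qed.

Lemma ddzbar_wirtinger (k : 'I_n) (g : V -> R[i]) z : ddzbar k g z =
  wirtinger 1 ('D_(X k) (fun y => complex.Re (g y)) z)
   ('D_(X k) (fun y => complex.Im (g y)) z)
   ('D_(Y k) (fun y => complex.Re (g y)) z) ('D_(Y k) (fun y => complex.Im (g y)) z).
Proof.
rewrite /ddzbar /ddx /ddy /real_derive /wirtinger.
move: ('D_(X k) _ z) ('D_(X k) _ z) ('D_(Y k) _ z) ('D_(Y k) _ z) => a b c d.
by rewrite mul1r.
Qed.

Lemma ddz_wirtinger (k : 'I_n) (g : V -> R[i]) z : ddz k g z =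
  wirtinger (-1) ('D_(X k) (fun y => complex.Re (g y)) z)
   ('D_(X k) (fun y => complex.Im (g y)) z)
   ('D_(Y k) (fun y => complex.Re (g y)) z) ('D_(Y k) (fun y => complex.Im (g y)) z).
Proof.
rewrite /ddz /ddx /ddy /real_derive /wirtinger.
move: ('D_(X k) _ z) ('D_(X k) _ z) ('D_(Y k) _ z) ('D_(Y k) _ z) => a b c d.
by rewrite rmorphN1 mulN1r.
Qed.

Lemma ddzbar_ofreal (k : 'I_n) f :
  ddzbar k (fun y => (f y)%:C) = fun y => ('D_(X k) f y / 2) +i* ('D_(Y k) f y / 2).
Proof.
apply/funext => y; rewrite ddzbar_wirtinger wirtingerE /= !derive_cst.
move: ('D_(X k) f y) ('D_(Y k) f y) => a b.
by rewrite mul1r subr0 add0r mul1r.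
Qed.

Lemma ddz_ofreal (k : 'I_n) f z :
  ddz k (fun y => (f y)%:C) z = ('D_(X k) f z / 2) +i* (- 'D_(Y k) f z / 2).
Proof.
rewrite ddz_wirtinger wirtingerE /= !derive_cst.
move: ('D_(X k) f z) ('D_(Y k) f z) => a b.
by rewrite mulr0 subr0 add0r mulN1r.
Qed.

Let wirtinger_quarter (a b c d : R) :
  wirtinger (-1) (a / 2) (b / 2) (c / 2) (d / 2) = ((a + d) / 4) +i* ((b - c) / 4).
Proof. by rewrite wirtingerE; congr (_ +i* _); field. Qed.

Lemma ddz_ddzbar U f z (j k : 'I_n) : open U -> smooth_on U f -> U z ->
  ddz j (ddzbar k (fun y => (f y)%:C)) z =
    (('D_(X j) ('D_(X k) f) z + 'D_(Y j) ('D_(Y k) f) z) / 4) +i*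
    (('D_(X j) ('D_(Y k) f) z - 'D_(Y j) ('D_(X k) f) z) / 4).
Proof.
move=> oU fs Uz; rewrite ddzbar_ofreal ddz_wirtinger /=.
have D v w : 'D_v (fun y => 'D_w f y / 2) z = 'D_v ('D_w f) z / 2.
  have -> : (fun y => 'D_w f y / 2) = 2^-1 *: ('D_w f).
    by apply/funext => y; rewrite fctE mulrC.
  rewrite deriveZ; last exact: smooth_derivable (smooth_derive w fs) Uz.
  by rewrite mulrC.
transitivity (wirtinger (-1) ('D_(X j) ('D_(X k) f) z / 2)
  ('D_(X j) ('D_(Y k) f) z / 2) ('D_(Y j) ('D_(X k) f) z / 2)
  ('D_(Y j) ('D_(Y k) f) z / 2)).
  by congr (wirtinger _ _ _ _ _); exact: D.
exact: wirtinger_quarter.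
Qed.

Let Re_quarter (a b c d p q r s : R) :
  complex.Re (((a + d) / 4 +i* ((b - c) / 4)) * (p +i* r) * conjc (q +i* s)) =
  (p * (q * a) + p * (s * b) + (r * (q * c) + r * (s * d)) +
  ((- r) * ((- s) * a) + (- r) * (q * b) + (p * ((- s) * c) + p * (q * d)))) / 4.
Proof. by rewrite /=; field. Qed.

Let ReD (I : finType) (F : I -> R[i]) :
  complex.Re (\sum_i F i) = \sum_i complex.Re (F i).
Proof. by apply: (big_morph (@complex.Re R)) => //; case=> [a b] [c d]. Qed.

Let levi_sum (H : 'I_n + 'I_n -> 'I_n + 'I_n -> R) v :
  \sum_j \sum_k complex.Re (
    ((H (inl j) (inl k) + H (inr j) (inr k)) / 4 +i*
     ((H (inl j) (inr k) - H (inr j) (inl k)) / 4)) *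
    cvec v 0 j * conjc (cvec v 0 k)) =
  (\sum_i \sum_k Cn_coord v i * (Cn_coord v k * H i k) +
   \sum_i \sum_k Cn_coord (Jc v) i * (Cn_coord (Jc v) k * H i k)) / 4.
Proof.
rewrite !big_sumType /= -!big_split mulr_suml /=; apply: eq_bigr => j _.
rewrite !big_sumType /= -!big_split mulr_suml /=; apply: eq_bigr => k _.
by rewrite !mxE Re_quarter.
Qed.

(** Expanding the pure second derivatives along [v] and [Jc v], the mixed terms
    combine into the imaginary parts of the entries of the complex Hessian, with the
    same order of differentiation on both sides. *)
Lemma Re_levi_form U f z v : open U -> smooth_on U f -> U z ->
  complex.Re (levi_form f z (cvec v)) = levi2 (@Jc R n) f z v / 4.
Proof.
move=> oU fs Uz; rewrite /levi_form ReD.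
have H1 := derive2_coord (@Cn_coordE R n) v v oU fs Uz.
have H2 := derive2_coord (@Cn_coordE R n) (Jc v) (Jc v) oU fs Uz.
rewrite /levi2 (f_equal2 +%R H1 H2) -levi_sum.
apply: eq_bigr => j _; rewrite ReD; apply: eq_bigr => k _.
by rewrite (ddz_ddzbar j k oU fs Uz).
Qed.

Let tangent_sum (d : 'I_n + 'I_n -> R) v :
  \sum_j (((d (inl j) / 2) +i* (- d (inr j) / 2)) * cvec v 0 j) =
  ((\sum_i Cn_coord v i * d i) / 2) +i* (- (\sum_i Cn_coord (Jc v) i * d i) / 2).
Proof.
rewrite !big_sumType /= -!big_split /=.
have S (F G : 'I_n -> R) : \sum_j ((F j / 2) +i* (- G j / 2)) =
    ((\sum_j F j) / 2) +i* (- (\sum_j G j) / 2) :> R[i].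
  apply: (big_ind3 (fun (x : R[i]) a b => x = (a / 2) +i* (- b / 2))) => //.
    by rewrite oppr0 !mul0r.
  move=> x1 a1 b1 x2 a2 b2 -> ->; apply/eqP; rewrite eq_complex /=.
  by rewrite opprD !mulrDl !eqxx.
rewrite -S; apply: eq_bigr => j _; rewrite !mxE; apply/eqP; rewrite eq_complex /=.
by apply/andP; split; apply/eqP; field.
Qed.

Lemma complex_tangent_cvec U f z v : open U -> smooth_on U f -> U z ->
  'D_v f z = 0 -> 'D_(Jc v) f z = 0 -> complex_tangent f z (cvec v).
Proof.
move=> oU fs Uz.
have H1 := derive_coord (@Cn_coordE R n) v oU fs Uz.
have H2 := derive_coord (@Cn_coordE R n) (Jc v) oU fs Uz.
move=> D1 D2; rewrite /complex_tangent.
under eq_bigr do rewrite ddz_ofreal.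
rewrite (tangent_sum (fun i => 'D_(Cn_basis R i) f z) v) -H1 -H2 D1 D2.
by rewrite oppr0 !mul0r.
Qed.

Lemma smooth_coord (i : 'I_n + 'I_n) : smooth_on setT (fun z : V => Cn_coord z i).
Proof.
apply: smooth_linear; first exact: openT.
  by move=> a u w; case: i => j /=; rewrite !mxE.
by move=> v; exact: Cn_coord_le.
Qed.

Lemma levi2_sqnorm z v : levi2 (@Jc R n) (@sqnorm R n) z v =
  4 * \sum_j (v.1 0 j ^+ 2 + v.2 0 j ^+ 2).
Proof.
pose c i := (fun z : V => Cn_coord z i).
have cs i : smooth_on setT (c i) by exact: smooth_coord.
have D i u y : 'D_u (c i) y = c i u.
  have [] // := @is_derive_linear R V (c i) y u.
  by move=> a x w; case: i => j; rewrite /c /= !mxE.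
have D2 i u : 'D_u ('D_u (c i * c i)) z = 2 * c i u ^+ 2.
  rewrite (derive2_mul u (@openT V) (cs i) (cs i) I) !D.
  have -> : 'D_u (c i) = cst (c i u) by apply/funext => y; exact: D.
  by rewrite derive_cst; ring.
have E : @sqnorm R n = fun y => \sum_i 1 * (c i * c i) y.
  apply/funext => y; rewrite /sqnorm big_sumType /= -big_split.
  by apply: eq_bigr => j _; rewrite /= /c !mul1r !expr2.
have ss i : smooth_on setT (c i * c i) by apply: smooth_mul => //; exact: openT.
have Dq u : 'D_u ('D_u (@sqnorm R n)) z = \sum_i 2 * c i u ^+ 2.
  have E1 y : setT y -> 'D_u (@sqnorm R n) y = \sum_i 1 * 'D_u (c i * c i) y.
    move=> _; apply: (derive_smooth_sum u (@openT V) I ss) => x _.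
    by rewrite E.
  have ss1 i : smooth_on setT ('D_u (c i * c i)) by exact: smooth_derive.
  rewrite (derive_smooth_sum u (@openT V) I ss1 E1).
  by apply: eq_bigr => i _; rewrite mul1r D2.
rewrite /levi2 (f_equal2 +%R (Dq v) (Dq (Jc v))) !big_sumType /= -!big_split mulr_sumr /=.
by apply: eq_bigr => j _; rewrite /c /= !mxE; ring.
Qed.

Lemma smooth_sqnorm : smooth_on setT (@sqnorm R n).
Proof.
pose c i := (fun z : V => Cn_coord z i).
have cs i : smooth_on setT (c i) by exact: smooth_coord.
have -> : @sqnorm R n = \sum_i (c i * c i).
  apply/funext => y; rewrite fct_sumE /sqnorm big_sumType /= -big_split.
  by apply: eq_bigr => j _; rewrite /= /c !expr2.
apply: (big_ind (smooth_on setT)).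
- by apply: (smooth_cst 0); exact: openT.
- by move=> f g; apply: smooth_add; exact: openT.
- by move=> i _; apply: smooth_mul => //; exact: openT.
Qed.

Lemma norm_le_sum v : `|v| ^+ 2 <= \sum_j (v.1 0 j ^+ 2 + v.2 0 j ^+ 2).
Proof.
have le1 j : v.1 0 j ^+ 2 + v.2 0 j ^+ 2 <= \sum_j (v.1 0 j ^+ 2 + v.2 0 j ^+ 2).
  rewrite (bigD1 j)//= lerDl; apply: sumr_ge0 => i _.
  by rewrite addr_ge0// sqr_ge0.
set S := \sum_j _ in le1 *.
have S0 : 0 <= S by apply: sumr_ge0 => i _; rewrite addr_ge0// sqr_ge0.
have le2 (x : R) : x ^+ 2 <= S -> `|x| <= Num.sqrt S.
  by move=> xS; rewrite -sqrtr_sqr ler_wsqrtr.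
have : `|v| <= Num.sqrt S.
  rewrite prod_normE ge_max /Num.Def.normr /= !mx_normrE; apply/andP.
  split; apply/bigmax_leP; split; rewrite ?sqrtr_ge0// => -[i j] _ /=.
    rewrite ord1; apply: le2; apply: le_trans (le1 j).
    by rewrite lerDl sqr_ge0.
  rewrite ord1; apply: le2; apply: le_trans (le1 j).
  by rewrite lerDr sqr_ge0.
move=> H; rewrite -[leRHS]sqr_sqrtr// ler_sqr ?nnegrE ?sqrtr_ge0//.
Qed.

End LeviForm.

(** * Property (P) and Diederich-Fornaess exponents *)

Section CollarInequality.
Variables (R : realType) (V : normedModType R) (J : V -> V).
Implicit Types (r f : V -> R) (U : set V) (z v : V).

Let assemble (theta x w k1 k a b p q r1 r2 l1 l2 : R) : x < 0 -> 0 < w ->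
  (x * ((k1 ^+ 2 - k) * w * p ^+ 2 + - k1 * w * l1) + 2 * (a * (- k1 * w * p)) + w * r1) +
  (x * ((k1 ^+ 2 - k) * w * q ^+ 2 + - k1 * w * l2) + 2 * (b * (- k1 * w * q)) + w * r2) +
  theta * (((x * (- k1 * w * p) + w * a) ^+ 2 + (x * (- k1 * w * q) + w * b) ^+ 2) / - (x * w)) =
  w * ((r1 + r2) - 2 * (a * (k1 * p)) - 2 * (b * (k1 * q)) - (- x) * (k1 * p) ^+ 2
    - (- x) * (k1 * q) ^+ 2 + (- x) * (k1 * (l1 + l2) + k * (p ^+ 2 + q ^+ 2))
    + theta * ((a + (- x) * (k1 * p)) ^+ 2 / (- x)) + theta * ((b + (- x) * (k1 * q)) ^+ 2 / (- x))).
Proof. by move=> x0 w0; field; rewrite (lt_eqF x0) (gt_eqF w0). Qed.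

(** The inequality that makes -(-rho)^(1 - theta) plurisubharmonic for
    rho = r exp(-psi), in the presence of the pseudoconvexity estimate for [r] and
    of a Levi form of [f] that is large compared with the constant of that
    estimate. *)
Lemma collar_inequality U r f z v (theta kappa C M : R) :
  open U -> smooth_on U r -> smooth_on U f -> U z ->
  0 < theta < 1 -> kappa = theta / 16 -> r z < 0 -> 0 <= f z <= 1 ->
  0 <= C -> 0 <= M ->
  M * `|v| ^+ 2 <= levi2 J f z v ->
  - (C * (- r z * `|v| ^+ 2)) - C * ((`|'D_v r z| + `|'D_(J v) r z|) * `|v|)
    <= levi2 J r z v ->
  C + C ^+ 2 / theta <= 2 * kappa * M ->
  0 <= levi2 J (r * (weight kappa \o f)) z v +
    theta * (gradsq J (r * (weight kappa \o f)) z v / - (r * (weight kappa \o f)) z).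
Proof.
move=> oU rs fs Uz th kE rz fz C0 M0 Lf Lr CM.
have s0 : 0 < - r z by rewrite oppr_gt0.
have w0 : 0 < weight kappa (f z) by exact: expR_gt0.
have ws : smooth_on U (weight kappa \o f).
  by apply: smooth_comp => //; exact: smooth1_weight.
have Dw u : 'D_u (weight kappa \o f) z =
    - (2 * kappa * (1 + f z)) * weight kappa (f z) * 'D_u f z.
  by have [_] := is_derive_comp1 (smooth_is_derive u fs Uz) (is_derive_weight kappa (f z)).
have D2w u : 'D_u ('D_u (weight kappa \o f)) z =
    ((2 * kappa * (1 + f z)) ^+ 2 - 2 * kappa) * weight kappa (f z) * 'D_u f z ^+ 2 +
    - (2 * kappa * (1 + f z)) * weight kappa (f z) * 'D_u ('D_u f) z.
  have [_] := @derive2_comp R V U f (weight kappa)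
    (fun t => - (2 * kappa * (1 + t)) * weight kappa t)
    (fun t => ((2 * kappa * (1 + t)) ^+ 2 - 2 * kappa) * weight kappa t) z u oU fs Uz
    (fun y _ => is_derive_weight kappa (f y)) (fun y _ => is_derive_weight2 kappa (f y)).
  exact.
have D1 u : 'D_u (r * (weight kappa \o f)) z =
    r z * 'D_u (weight kappa \o f) z + weight kappa (f z) * 'D_u r z.
  by rewrite (deriveM (smooth_derivable u rs Uz) (smooth_derivable u ws Uz)).
have K := @collar_algebra R theta kappa (- r z) (f z) ('D_v r z) ('D_(J v) r z)
  ('D_v f z) ('D_(J v) f z) _ _ _ C M th kE s0 fz C0 Lf M0 Lr CM.
have E1 u : 'D_u (r * (weight kappa \o f)) z =
    r z * (- (2 * kappa * (1 + f z)) * weight kappa (f z) * 'D_u f z) +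
    weight kappa (f z) * 'D_u r z.
  by rewrite D1 Dw.
have E2 u := etrans (derive2_mul u oU rs ws Uz) (f_equal2 +%R (f_equal2 +%R
  (f_equal (fun x => r z * x) (D2w u)) (f_equal (fun x => 2 * ('D_u r z * x)) (Dw u)))
  (erefl (weight kappa (f z) * 'D_u ('D_u r) z))).
rewrite /levi2 (f_equal2 +%R (E2 v) (E2 (J v))) /gradsq (E1 v) (E1 (J v)).
rewrite -[(r * _) z]/(r z * weight kappa (f z)) (assemble _ _ _ _ _ _ _ _ _ _ _ rz w0).
by rewrite pmulr_rge0//; exact: K.
Qed.

End CollarInequality.

Section DiederichFornaess.
Variables (R : realType) (n : nat).
Local Notation V := (Cn R n).

Lemma defining_function_bdry (Omega U : set V) (r : V -> R) (z : V) :
  open Omega -> closure Omega `<=` U -> smooth_on U r ->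
  Omega = U `&` [set z | r z < 0] -> bdry Omega z -> r z = 0.
Proof.
move=> oO OU rs OE bz; have [cz _] := bz; have Uz := OU _ cz.
apply/eqP; rewrite eq_le; apply/andP; split; rewrite leNgt; apply/negP => rz.
  have [y [Oy ry]] := cz _ (cvgr_gt (r z) (smooth_continuous rs Uz) 0 rz).
  by move: Oy; rewrite OE => -[_] /= /(lt_trans ry); rewrite ltxx.
by apply: (bdry_not_in oO bz); rewrite OE.
Qed.

(** The Levi form of the squared norm is the squared Euclidean norm, which dominates
    the square of the maximum norm used in the estimates. *)
Lemma property_P_levi2 (Omega U : set V) (f : V -> R) (M : R) :
  open U -> closure Omega `<=` U -> smooth_on U f ->
  (forall z, bdry Omega z -> forall w,
     (M%:C * levi_form (@sqnorm R n) z w <= levi_form f z w)%C) ->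
  0 < M ->
  forall z, bdry Omega z -> forall v, 4 * M * `|v| ^+ 2 <= levi2 (@Jc R n) f z v.
Proof.
move=> oU OU fs HM M0 z bz v; have Uz : U z by apply: OU; case: bz.
have := HM z bz (cvec v); rewrite lecE => /andP[_].
rewrite (Re_levi_form v oU fs Uz).
have -> : complex.Re ((M%:C)%C * levi_form (@sqnorm R n) z (cvec v)) =
    M * complex.Re (levi_form (@sqnorm R n) z (cvec v)).
  by case: (levi_form _ _ _) => a b /=; rewrite mul0r subr0.
rewrite (Re_levi_form v (@openT V) (@smooth_sqnorm R n) I) levi2_sqnorm.
have := norm_le_sum v; move: (\sum_j _) => S NS.
move: (levi2 _ _ _ _) => L; have : M * `|v| ^+ 2 <= M * S by rewrite ler_pM2l.
lra.
Qed.

(** The constant [C0] of the pseudoconvexity estimate depends on [r] alone, so the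
    bound [M] in property (P) may be chosen after it.  The depth [b] of the collar
    comes last, since the region where the Levi form of [f] is large depends on
    [M]. *)
Lemma DF_exponent_property_P (Omega : set V) (theta : R) :
  domain Omega -> bounded_set Omega -> pseudoconvex Omega -> property_P Omega ->
  0 < theta -> theta < 1 / 5 -> DF_exponent Omega (1 - 5 * theta).
Proof.
move=> [_ oO _] bO [r [U0 [oU0 OU0 rs OE dr]] pc] pP t0 t1.
split; first by apply/andP; split; lra.
have cO := closure_compact bO.
have r0 z : bdry Omega z -> r z = 0 by exact: defining_function_bdry oO OU0 rs OE.
have rneg z : Omega z -> r z < 0 by rewrite OE => -[].
have OU0' z : Omega z -> U0 z by rewrite OE => -[].
have bU0 z : bdry Omega z -> U0 z by move=> [cz _]; exact: OU0.
have pc2 p : bdry Omega p -> forall v, 'D_v r p = 0 -> 'D_(Jc v) r p = 0 ->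
    0 <= levi2 (@Jc R n) r p v.
  move=> bp v D1 D2; have Up := bU0 p bp.
  have := pc p bp _ (complex_tangent_cvec oU0 rs Up D1 D2).
  rewrite lecE => /andP[_]; rewrite (Re_levi_form v oU0 rs Up) /=.
  by rewrite pmulr_lge0 ?invr_gt0.
have [C0 C00 HC0] : exists2 C, 0 < C & forall z, Omega z -> - C^-1 < r z ->
    Omega z -> forall v,
    - (C * (- r z * `|v| ^+ 2)) - C * ((`|'D_v r z| + `|'D_(Jc v) r z|) * `|v|)
    <= levi2 (@Jc R n) r z v.
  apply: (collar_uniform cO oO OU0 rs rneg).
    move=> C C' z CC' H Oz v; apply: le_trans (H Oz v).
    rewrite lerD// lerN2 ler_wpM2r// mulr_ge0 ?addr_ge0 ?sqr_ge0//.
    by rewrite oppr_ge0 ltW// rneg.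
  move=> p bp.
  have [C HC] := pseudoconvex_local (@Cn_coordE R n) (@Cn_coord_le R n) (@JcD R n)
    (@JcZ R n) (@JcJc R n) (@norm_Jc R n) oU0 rs OU0 OE r0 dr pc2 bp.
  by exists C; apply: filterS HC => z H Oz; exact: H.
pose kappa := theta / 16.
have k0 : 0 < kappa by rewrite divr_gt0.
pose M := (C0 + C0 ^+ 2 / theta) / (2 * kappa).
have M0 : 0 < M.
  by rewrite divr_gt0 ?mulr_gt0// addr_gt0// divr_gt0// exprn_gt0.
have [f [[U1 [oU1 OU1 fs]] _ f01 fM]] := pP M M0.
have fL := property_P_levi2 oU1 OU1 fs fM M0.
have [C1 C10 HC1] : exists2 C, 0 < C & forall z, Omega z -> - C^-1 < r z ->
    forall v, 4 * M / 2 * `|v| ^+ 2 <= levi2 (@Jc R n) f z v.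
  apply: (collar_uniform cO oO OU0 rs rneg (P := fun _ z =>
    forall v, 4 * M / 2 * `|v| ^+ 2 <= levi2 (@Jc R n) f z v)) => //.
  move=> p bp; exists 0.
  have Up : U1 p by apply: OU1; case: bp.
  have H := levi2_near (@Cn_coordE R n) (@Cn_coord_le R n) (@norm_Jc R n) oU1 fs Up
    (mulr_gt0 (ltr0n _ 4) M0) (fL p bp).
  by apply: filterS H => z H _.
pose W := U0 `&` U1.
have oW : open W by exact: openI.
have OW : closure Omega `<=` W by move=> z cz; split; [exact: OU0|exact: OU1].
have OW' z : Omega z -> W z by move=> Oz; apply: OW; exact: subset_closure.
have rsW : smooth_on W r by apply: smooth_onS rs; exact: subIsetl.
have fsW : smooth_on W f by apply: smooth_onS fs; exact: subIsetr.
pose w := weight kappa \o f.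
have wpos z : 0 < w z by exact: expR_gt0.
have wsW : smooth_on W w by apply: smooth_comp => //; exact: smooth1_weight.
pose rho := r * w.
have rhoE z : rho z = r z * w z by [].
have rhosW : smooth_on W rho by exact: smooth_mul.
have rhoneg z : (rho z < 0) = (r z < 0) by rewrite rhoE pmulr_llt0.
pose b := Num.min (1 / 4) (Num.min (C0^-1 / 2) (C1^-1 / 2)).
have b0 : 0 < b by rewrite !lt_min !divr_gt0 ?invr_gt0.
have b1 : b <= 1 / 4 by rewrite ge_min lexx.
have bC0 : 2 * b <= C0^-1.
  have : b <= C0^-1 / 2 by rewrite !ge_min lexx orbT.
  lra.
have bC1 : 2 * b <= C1^-1.
  have : b <= C1^-1 / 2 by rewrite !ge_min lexx !orbT.
  lra.
(* The factor exp(-psi) is at least 1/2, hence the factor 2 in the depths. *)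
have collar z : Omega z -> - b < rho z -> - (2 * b) < r z.
  move=> Oz; rewrite rhoE.
  have : 1 / 2 <= w z.
    have /andP[f0 f1] := f01 z Oz.
    apply: le_trans (expR_ge1Dx _).
    have : (1 + f z) ^+ 2 <= 2 ^+ 2 by rewrite ler_sqr ?nnegrE; lra.
    move=> /(ler_wpM2l (ltW k0)); rewrite /kappa; lra.
  move: (w z) (r z) (rneg z Oz) => x y; nra.
have [h [P1 [P2 [hs h0 h'0 hneg hP]]]] := cutoff t0 t1 b0 b1.
exists (h \o rho).
  exists W; split; [exact: oW|exact: OW|exact: smooth_comp| |].
  - apply/seteqP; split => z /=.
      by move=> Oz; split; [exact: OW'|rewrite hneg rhoneg rneg].
    by rewrite hneg rhoneg => -[[Uz _] rz]; rewrite OE.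
  - move=> z bz; have [v vN] := dr z bz; exists v.
    have Wz : W z by apply: OW; case: bz.
    have [_ ->] := is_derive_comp1 (smooth_is_derive v rhosW Wz)
      (smooth1_is_derive (rho z) hs).
    have -> : rho z = 0 by rewrite rhoE r0// mul0r.
    apply: mulf_neq0; first by rewrite gt_eqF.
    rewrite (deriveM (smooth_derivable v rsW Wz) (smooth_derivable v wsW Wz)).
    rewrite r0// scale0r add0r; apply: mulf_neq0 => //.
    by rewrite gt_eqF.
have rhosO : smooth_on Omega rho by exact: smooth_onS rhosW.
have rhoO z : Omega z -> rho z < 0 by move=> Oz; rewrite rhoneg rneg.
pose Phi s := - ((- h s) `^ (1 - 5 * theta)).
have Phi1 z : Omega z -> is_derive (rho z) 1 Phi (P1 (rho z)).
  by move=> Oz; have [] := hP _ (rhoO z Oz).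
have Phi2 z : Omega z -> is_derive (rho z) 1 P1 (P2 (rho z)).
  by move=> Oz; have [] := hP _ (rhoO z Oz).
rewrite -[X in psh_on _ X]/(Phi \o rho).
apply: psh_levi2; first exact: oO.
- move=> z Oz; apply: continuous_comp; first exact: smooth_continuous rhosO Oz.
  by apply/differentiable_continuous/derivable1_diffP; have [] := Phi1 z Oz.
- move=> z v Oz.
  by have [] := is_derive_comp1 (smooth_is_derive v rhosO Oz) (Phi1 z Oz).
- by move=> z v Oz; have [] := derive2_comp v oO rhosO Oz Phi1 Phi2.
move=> z v Oz.
rewrite (levi2_comp (@Jc R n) v oO rhosO Oz Phi1 Phi2).
have [_ _ P10 Pflat Pconv] := hP _ (rhoO z Oz).
have [far|near] := leP (rho z) (- b).
  by have [-> ->] := Pflat far; rewrite !mul0r addr0.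
have cz := collar z Oz near.
have /andP[f0 f1] := f01 z Oz.
have th : 0 < theta < 1 by rewrite t0; lra.
have L1 : M * `|v| ^+ 2 <= levi2 (@Jc R n) f z v.
  have : 4 * M / 2 * `|v| ^+ 2 <= levi2 (@Jc R n) f z v by apply: HC1 => //; lra.
  apply: le_trans; rewrite ler_wpM2r ?sqr_ge0//; lra.
have L2 : - C0^-1 < r z by lra.
have CM : C0 + C0 ^+ 2 / theta <= 2 * kappa * M.
  by rewrite /M [2 * kappa * _]mulrC divfK ?lexx// gt_eqF ?mulr_gt0.
have := collar_inequality oW rsW fsW (OW' z Oz) th erefl (rneg z Oz) (f01 z Oz)
  (ltW C00) (ltW M0) L1 (HC0 z Oz L2 Oz v) CM.
rewrite -/w -/rho.
have g0 : 0 <= gradsq (@Jc R n) rho z v by rewrite addr_ge0 ?sqr_ge0.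
move: (levi2 _ _ _ _) (gradsq _ _ _ _) g0 => L G G0 H.
have s0 : 0 < - rho z by rewrite oppr_gt0 rhoO.
have /(_ near) := Pconv.
move: (P1 _) (P2 _) P10 => p1 p2 p10 conv.
have : theta * p1 * (G / - rho z) <= p2 * - rho z * (G / - rho z).
  by rewrite ler_wpM2r// divr_ge0// ltW.
have -> : p2 * - rho z * (G / - rho z) = p2 * G by rewrite -mulrA [_ * (_ / _)]mulrC divfK ?gt_eqF.
have := mulr_ge0 p10 H; move: (G / - rho z) => X; lra.
Qed.

End DiederichFornaess.

Theorem corollary1p4 (R : realType) (n : nat) (Omega : set (Cn R n))
    (Omega_domain : domain Omega)
    (Omega_bounded : bounded_set Omega)
    (Omega_smooth : smooth_boundary Omega)
    (Omega_pseudoconvex : pseudoconvex Omega)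
    (Omega_P : property_P Omega) :
  DF_index Omega = 1.
Proof.
rewrite /DF_index.
have -> : [set eta | DF_exponent Omega eta] = [set` `]0, 1[%R].
  apply/seteqP; split => eta /=; first by rewrite in_itv => -[].
  rewrite in_itv /= => /andP[eta0 eta1].
  have -> : eta = 1 - 5 * ((1 - eta) / 5) by field.
  by apply: DF_exponent_property_P => //; lra.
by rewrite sup_itv// bnd_simp ltr01.
Qed.
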